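(* Let $T>0$ and let $\Omega\subseteq\mathbb{R}^n$ be a domain with smooth boundary which is either bounded and convex, or unbounded, convex and satisfying the interior cone condition. Let $Q_T=\Omega\times(0,T)$ and $\Sigma_T=\partial\Omega\times(0,T)$, and let $\nu$ be the outward unit normal to $\partial\Omega$. Assume that $H\in W^{1,\infty}_{\mathrm{loc}}(\mathbb{R}^n)$ and $f\in W^{1,\infty}(Q_T)$. For $\varepsilon>0$ let $u_\varepsilon$ be a (classical, $C^{2,1}$) Lipschitz solution of $$\begin{cases}-\partial_t u_\varepsilon-\varepsilon\Delta u_\varepsilon+H(Du_\varepsilon(x,t))=f(x,t)&\text{in }Q_T,\\ \partial_\nu u_\varepsilon=0&\text{on }\Sigma_T,\\ u_\varepsilon(x,T)=u_T(x)&\text{in }\Omega,\end{cases}$$ and let $u$ be a Lipschitz viscosity solution of $$\begin{cases}-\partial_t u+H(Du(x,t))=f(x,t)&\text{in }Q_T,\\ \partial_\nu u=0&\text{on }\Sigma_T,\\ u(x,T)=u_T(x)&\text{in }\Omega.\end{cases}$$ Then $$\|u_\varepsilon-u\|_{L^\infty(Q_T)}\le M\sqrt{\varepsilon T}$$ for a positive constant $M$ depending on $\|Du\|_{L^\infty(\overline{Q}_T)}$, $n$ and $\|Df\|_{L^\infty(Q_T)}$.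
   Context: Interior cone condition: there exists a finite cone such that every point of $\Omega$ is the vertex of a cone, congruent to the fixed given cone, contained in $\Omega$. $D$ and $\Delta$ denote the gradient and Laplacian in the space variable $x$; $C^{2,1}$ means twice continuously differentiable in $x$ and once in $t$. For the first-order problem, the equation and the Neumann condition are understood in the viscosity sense: $u$ is continuous on $\overline{\Omega}\times[0,T]$, $u(\cdot,T)=u_T$, and for every $C^1$ test function $\varphi$: if $u-\varphi$ has a local maximum (relative to $\overline\Omega\times(0,T)$) at $(x_0,t_0)$, then $-\partial_t\varphi+H(D\varphi)-f\le 0$ at $(x_0,t_0)$ if $x_0\in\Omega$, and $\min\{-\partial_t\varphi+H(D\varphi)-f,\ \partial_\nu\varphi\}\le 0$ at $(x_0,t_0)$ if $x_0\in\partial\Omega$; if $u-\varphi$ has a local minimum at $(x_0,t_0)$, then $-\partial_t\varphi+H(D\varphi)-f\ge 0$ if $x_0\in\Omega$, and $\max\{-\partial_t\varphi+H(D\varphi)-f,\ \partial_\nu\varphi\}\ge 0$ if $x_0\in\partial\Omega$. Standing convention: the result is stated as an a priori estimate. The viscous problem is assumed to admit classical solutions $u_\varepsilon\in C^{2,1}$, with enough qualitative regularity to justify differentiating the equation and integrating by parts (for unbounded $\Omega$ this can be ensured, for instance, by assuming in addition that $\Omega$ is uniformly regular of class $C^k$; this is only qualitative and does not enter the constants). The constant $M$ does not depend on $\varepsilon$.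
   Formalization: The constant M may also depend, nondecreasingly, on T: with M depending only on n, ‖Du‖ and ‖Df‖ the bound fails for large T (n=1, Ω=(-1,1), H(p)=p², f=|x|, u_T=0, ε=1). *)

(* Defs.v *)
From HB Require Import structures.
From mathcomp Require Import all_boot all_order all_algebra.
From mathcomp Require Import all_classical all_reals all_analysis.

Set Implicit Arguments.
Unset Strict Implicit.
Unset Printing Implicit Defensive.

Import Order.TTheory GRing.Theory Num.Theory.
Import numFieldNormedType.Exports.

Local Open Scope classical_set_scope.
Local Open Scope ring_scope.

(* The library norm on ['rV[R]_n] is the sup norm; it is only used here for
   notions that do not depend on the choice of an equivalent norm (topology,
   boundedness, being Lipschitz for some constant).  Lengths of gradients, the
   unit normal and cones use the Euclidean norm [enorm]. *)
Section euclidean.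
Context {R : realType} {n : nat}.
Implicit Types x y : 'rV[R]_n.

Definition dot x y : R := \sum_i x 0 i * y 0 i.

Definition enorm x : R := Num.sqrt (dot x x).

Definition basis_vec (i : 'I_n) : 'rV[R]_n := delta_mx 0 i.

Definition grad (g : 'rV[R]_n -> R) x : 'rV[R]_n :=
  \row_i 'D_(basis_vec i) g x.

End euclidean.

Section domains.
Context {R : realType} {n : nat}.
Implicit Types (Om U : set 'rV[R]_n) (x nu : 'rV[R]_n).

Definition frontier Om : set 'rV[R]_n := closure Om `\` interior Om.

Definition is_domain Om : Prop := [/\ open Om, Om !=set0 & connected Om].

Definition convex_domain Om : Prop := convex_set (Om : set (convex_lmodType 'rV[R]_n)).

Fixpoint Ck_on U (k : nat) (g : 'rV[R]_n -> R) : Prop :=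
  (forall x, U x -> {for x, continuous g}) /\
  if k is k'.+1 then
    forall i, (forall x, U x -> derivable g x (basis_vec i)) /\
              Ck_on U k' (fun x => 'D_(basis_vec i) g x)
  else True.

Definition smooth_on U (g : 'rV[R]_n -> R) : Prop := forall k, Ck_on U k g.

Definition local_defining_function Om x0 (rho : 'rV[R]_n -> R) : Prop :=
  exists2 U, open_nbhs x0 U &
  [/\ smooth_on U rho, grad rho x0 != 0 &
      forall x, U x -> (Om x <-> rho x < 0)].

Definition smooth_boundary Om : Prop :=
  forall x0, frontier Om x0 -> exists rho, local_defining_function Om x0 rho.

Definition outward_unit_normal Om x0 nu : Prop :=
  exists2 rho, local_defining_function Om x0 rho &
  nu = (enorm (grad rho x0))^-1 *: grad rho x0.

(* Spherical cone with vertex [x], axis [xi] (a unit vector), half-aperture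
   [theta] and height [h]; two such cones are congruent when they have the same
   [theta] and [h]. *)
Definition finite_cone x (xi : 'rV[R]_n) (theta h : R) : set 'rV[R]_n :=
  [set y | enorm (y - x) <= h /\ enorm (y - x) * cos theta <= dot (y - x) xi].

Definition interior_cone_condition Om : Prop :=
  exists theta h : R, [/\ 0 < theta, theta < pi / 2, 0 < h &
    forall x, Om x ->
      exists2 xi, enorm xi = 1 & finite_cone x xi theta h `<=` Om].

End domains.

Section space_time.
Context {R : realType} {n : nat}.
Implicit Types (Om : set 'rV[R]_n) (v : 'rV[R]_n * R -> R) (p : 'rV[R]_n * R).

Definition cylinder Om (T : R) : set ('rV[R]_n * R) := Om `*` `]0, T[.

Definition closed_cylinder Om (T : R) : set ('rV[R]_n * R) :=
  closure Om `*` `[0, T].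

Definition dt v p : R := 'D_1 (fun s : R => v (p.1, s)) p.2.

Definition dx (i : 'I_n) v p : R := 'D_(basis_vec i) (fun y => v (y, p.2)) p.1.

Definition Dx v p : 'rV[R]_n := grad (fun y => v (y, p.2)) p.1.

Definition laplacian v p : R := \sum_i dx i (dx i v) p.

Definition derivable_t v p : Prop := derivable (fun s : R => v (p.1, s)) p.2 1.

Definition derivable_x (i : 'I_n) v p : Prop :=
  derivable (fun y => v (y, p.2)) p.1 (basis_vec i).

(* For open [A]. *)
Definition C1_on (A : set ('rV[R]_n * R)) v : Prop :=
  forall p, A p ->
  [/\ {for p, continuous v},
      derivable_t v p /\ {for p, continuous (dt v)} &
      forall i, derivable_x i v p /\ {for p, continuous (dx i v)}].

(* For open [A]: twice continuously differentiable in [x], once in [t]. *)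
Definition C21_on (A : set ('rV[R]_n * R)) v : Prop :=
  C1_on A v /\
  forall p, A p -> forall i j,
    derivable_x i (dx j v) p /\ {for p, continuous (dx i (dx j v))}.

End space_time.

Section lebesgue_null_sets.
Context {R : realType} {n : nat}.
Implicit Types (a b : 'rV[R]_n * R) (A N : set ('rV[R]_n * R)).

Definition box a b : set ('rV[R]_n * R) :=
  [set p : 'rV[R]_n * R | (forall i, a.1 0 i <= p.1 0 i <= b.1 0 i) /\ a.2 <= p.2 <= b.2].

Definition box_volume a b : R :=
  (\prod_i (b.1 0 i - a.1 0 i)) * (b.2 - a.2).

(* Null sets for Lebesgue measure on R^n x R: coverable by countably many boxes
   of arbitrarily small total volume. *)
Definition lebesgue_null N : Prop :=
  forall e : R, 0 < e -> exists a b : nat -> 'rV[R]_n * R,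
  [/\ forall k, (forall i, (a k).1 0 i <= (b k).1 0 i) /\ (a k).2 <= (b k).2,
      N `<=` \bigcup_k box (a k) (b k) &
      (\sum_(0 <= k <oo) (box_volume (a k) (b k))%:E <= e%:E)%E].

Definition Linfty_norm A (g : 'rV[R]_n * R -> \bar R) : \bar R :=
  ereal_inf [set c | lebesgue_null (A `&` [set p | ~ (`|g p| <= c)%E])].

(* Length of the spatial gradient.  The value +oo at points where [v] is not
   differentiable in [x] prevents the default value of ['D_] from counting; for
   Lipschitz [v] these points form a null set (Rademacher). *)
Definition grad_length (v : 'rV[R]_n * R -> R) (p : 'rV[R]_n * R) : \bar R :=
  if `[< differentiable (fun y => v (y, p.2)) p.1 >] then (enorm (Dx v p))%:E
  else +oo%E.

End lebesgue_null_sets.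

(* W^{1,oo} functions are identified with their Lipschitz representatives: on a
   convex set W^{1,oo} consists exactly of the bounded Lipschitz functions. *)
Definition W1infty {R : realType} {V : normedModType R} (A : set V) (g : V -> R) : Prop :=
  [bounded g x | x in A] /\ [lipschitz g x | x in A].

Definition W1infty_loc {R : realType} {V : normedModType R} (g : V -> R) : Prop :=
  forall r : R, 0 < r -> W1infty (ball (0 : V) r) g.

Section equations.
Context {R : realType} {n : nat}.
Variables (Om : set 'rV[R]_n) (T : R) (nu : 'rV[R]_n -> 'rV[R]_n).
Variables (H : 'rV[R]_n -> R) (f : 'rV[R]_n * R -> R) (uT : 'rV[R]_n -> R).
Implicit Types (u phi : 'rV[R]_n * R -> R) (p : 'rV[R]_n * R).

(* Functions are total, so their values off the closed cylinder are irrelevant;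
   accordingly the normal derivative on the boundary is taken from inside. *)
Definition neumann_condition u : Prop :=
  forall x t, frontier Om x -> 0 < t < T ->
  h^-1 * (u (x, t) - u (x - h *: nu x, t)) @[h --> (0 : R)^'+] --> (0 : R).

Definition viscous_solution (eps : R) u : Prop :=
  [/\ {within closed_cylinder Om T, continuous u},
      C21_on (cylinder Om T) u,
      forall p, cylinder Om T p ->
        - dt u p - eps * laplacian u p + H (Dx u p) = f p,
      neumann_condition u &
      forall x, Om x -> u (x, T) = uT x].

Definition local_max_on (A : set ('rV[R]_n * R)) (g : 'rV[R]_n * R -> R) p : Prop :=
  A p /\ \forall q \near p, A q -> g q <= g p.

Definition local_min_on (A : set ('rV[R]_n * R)) (g : 'rV[R]_n * R -> R) p : Prop :=
  A p /\ \forall q \near p, A q -> g p <= g q.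

Definition residual phi p : R := - dt phi p + H (Dx phi p) - f p.

Definition normal_derivative phi p : R := dot (Dx phi p) (nu p.1).

Definition viscosity_subsolution u : Prop :=
  forall phi p, C1_on (setT `*` `]0, T[) phi ->
  local_max_on (cylinder (closure Om) T) (fun q => u q - phi q) p ->
  (Om p.1 -> residual phi p <= 0) /\
  (frontier Om p.1 -> Num.min (residual phi p) (normal_derivative phi p) <= 0).

Definition viscosity_supersolution u : Prop :=
  forall phi p, C1_on (setT `*` `]0, T[) phi ->
  local_min_on (cylinder (closure Om) T) (fun q => u q - phi q) p ->
  (Om p.1 -> 0 <= residual phi p) /\
  (frontier Om p.1 -> 0 <= Num.max (residual phi p) (normal_derivative phi p)).

Definition viscosity_solution u : Prop :=
  [/\ {within closed_cylinder Om T, continuous u},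
      viscosity_subsolution u,
      viscosity_supersolution u &
      forall x, Om x -> u (x, T) = uT x].

End equations.

(* Main.v *)
Require Import Defs.
From HB Require Import structures.
From mathcomp Require Import all_boot all_order all_algebra.
From mathcomp Require Import all_classical all_reals all_analysis.
From mathcomp Require Import measurable_realfun ring lra.

Set Implicit Arguments.
Unset Strict Implicit.
Unset Printing Implicit Defensive.

Import Order.TTheory GRing.Theory Num.Theory.
Import numFieldNormedType.Exports.

Local Open Scope classical_set_scope.
Local Open Scope ring_scope.

(** Doubling of variables. Write [d] for the square root of [eps * T] and
    consider the maximum over [x, y] in the closure of [Om] and over times [t],
    [s] of
      [ueps (x, t) - u (y, s) - lam (T - t) - |x - y|^2 / (2 d)
        - (t - s)^2 / (2 tau) - eta / 2 (|x - x0|^2 + |y - x0|^2)].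
    As [u] is Lipschitz in space with a constant [k] controlled by [K], the
    maximum satisfies [|x - y| <= 2 d (k + 1)]. The [eta]-term gives compactness
    when [Om] is unbounded; on a convex domain it also makes the gradient of the
    penalty point strictly outwards at the boundary, which contradicts the
    Neumann condition for [ueps] and rules out the boundary alternative in the
    viscosity inequality for [u]. At interior times the two equations therefore
    hold at the maximum, with nearly the same gradient (so only the local
    Lipschitz continuity of [H] matters) and with a Laplacian of [ueps] of at
    most [n (1 / d + eta)]. Subtracting them gives
      [lam <= eps n / d + l |x - y|],
    with [l] the Lipschitz constant of [f] in space and up to terms vanishing
    with [eta] and [tau]; this fails for some [lam] proportional to [d]. For
    that [lam] one of the two times is [T], where [ueps] and [u] agree; the
    functional is then at most of order [d], and so is [ueps - u] up to
    [lam * T] ([half_estimate]). The reverse inequality is the same statement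
    for [- ueps], [- u], [- H (- p)] and [- f]
    ([comparison_pair_of_solutions]).

    The constants [K] and [L] are essential bounds of gradients, whereas the
    argument needs Lipschitz bounds ([grad_bound_lipschitz]). These come from
    axis-parallel lines: averaging over boxes produces, close to any such
    segment, a parallel one that meets the exceptional null set in a set of
    small length ([null_set_line]), and along it the function grows at most as
    the gradient bound allows, plus its Lipschitz constant times that length
    ([slope_le_outside_increment]). Working with coordinate directions costs
    only a factor [n]. *)

(** * Increments of functions of one variable *)

Section one_variable.
Context {R : realType}.
Implicit Types (g : R -> R) (a b c s : R).

(** A bound on the upper derivative in straddled form, [u <= s <= v], which is
    what the supremum argument of [locally_nondecreasing_le] can use. *)
Definition slope_le g c s := forall e, 0 < e -> exists2 r, 0 < r &
  forall u v, s - r < u -> u <= s -> s <= v -> v < s + r ->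
  g v - g u <= (c + e) * (v - u).

(** No continuity is assumed: the supremum of the points where [G] is at least
    [G a] is attained and cannot be less than [b], because [G] is compared on
    the two sides of that supremum. *)
Lemma locally_nondecreasing_le (G : R -> R) a b : a <= b ->
  (forall s, a <= s <= b -> exists2 r, 0 < r &
     forall u v, a <= u -> v <= b -> s - r < u -> u <= s -> s <= v ->
       v < s + r -> G u <= G v) ->
  G a <= G b.
Proof.
move=> ab incr.
pose S := [set s | a <= s <= b /\ G a <= G s].
have Sa : S a by split; rewrite ?lexx ?ab.
have supS : has_sup S.
  by split; [exists a | exists b => s [/andP[]]].
have le_s s : S s -> s <= sup S by move=> Ss; exact: (ub_le_sup supS.2 Ss).
have as0 : a <= sup S by exact: le_s.
have s0b : sup S <= b by apply: ge_sup => [|s [/andP[]]]; [exists a | ].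
have [|r r0 near_s0] := incr (sup S); first by rewrite as0 s0b.
have [u Su su] := sup_adherent r0 supS.
have [/andP[au ub] Gau] := Su.
have us0 := le_s _ Su.
have Gas v : sup S <= v -> v <= b -> v < sup S + r -> G a <= G v.
  by move=> sv vb vr; apply: le_trans Gau (near_s0 u v au vb su us0 sv vr).
move: (s0b); rewrite le_eqVlt => /orP[/eqP <-|s0b'].
  by apply: Gas => //; rewrite ltrDl.
pose v := Num.min b (sup S + r / 2).
have r2 : 0 < r / 2 by rewrite divr_gt0.
have sv : sup S < v by rewrite lt_min s0b' ltrDl.
have vb : v <= b by rewrite ge_min lexx.
have vr : v < sup S + r.
  by apply: (@le_lt_trans _ _ (sup S + r / 2)); [rewrite ge_min lexx orbT|lra].
have Sv : S v by split; [rewrite vb (le_trans as0 (ltW sv))|exact: Gas (ltW sv) vb vr].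
by have := le_s _ Sv; rewrite leNgt sv.
Qed.

(** A mean value inequality in which the exact derivative is replaced by an
    upper slope; an arbitrarily small tilt [e] makes the function locally
    monotone. *)
Lemma slope_le_increment g a b c : a <= b ->
  (forall s, a <= s <= b -> slope_le g c s) -> g b - g a <= c * (b - a).
Proof.
move=> ab gc; apply/ler_addgt0Pl => e e0.
have b1 : 0 < b - a + 1 by lra.
pose e' := e / (b - a + 1).
have e'0 : 0 < e' by rewrite divr_gt0.
have : (c + e') * a - g a <= (c + e') * b - g b.
  apply: (@locally_nondecreasing_le (fun t => (c + e') * t - g t) a b ab) => s sab.
  have [r r0 h] := gc s sab e' e'0; exists r => // u v _ _ su us sv vs.
  by have := h u v su us sv vs; lra.
have : e' * (b - a) <= e by rewrite /e' -mulrA ler_piMr ?(ltW e0)// mulrC ler_pdivrMr//; lra.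
lra.
Qed.

End one_variable.

Section directional.
Context {R : realType} {V : normedModType R}.
Implicit Types (f : V -> R) (x v : V).

Lemma derivable_increment f x v : derivable f x v -> forall e, 0 < e ->
  exists2 r, 0 < r & forall h, `|h| < r ->
    `|f (x + h *: v) - f x - h * 'D_v f x| <= e * `|h|.
Proof.
move=> /derivable_nbhs /eqaddoP H e e0.
have := H e e0; rewrite -nbhs_nearE => /nbhs_ballP[r /= r0 hr].
exists r => // h hh; have := hr h; rewrite /ball /= sub0r normrN => /(_ hh) /=.
by rewrite /= -![(_ - _ : _ -> _) _]/(_ - _) /= /cst /= opprD addrA (addrC (h *: v)).
Qed.

Lemma derivable_slope_le f x v s c : derivable f (x + s *: v) v ->
  'D_v f (x + s *: v) <= c -> slope_le (fun t => f (x + t *: v)) c s.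
Proof.
move=> df dc e e0; have [r r0 hr] := derivable_increment df e0.
exists r => // u w su us sw ws.
have := hr (u - s); have := hr (w - s).
rewrite -!addrA -!scalerDl !subrKC.
rewrite (ger0_norm (_ : 0 <= w - s)) ?subr_ge0// (ler0_norm (_ : u - s <= 0)) ?subr_le0//.
move=> /(_ ltac:(lra)) /ler_normlP[_ h1] /(_ ltac:(lra)) /ler_normlP[h2 _].
have : 0 <= (c - 'D_v f (x + s *: v)) * (w - u) by apply: mulr_ge0; lra.
lra.
Qed.

Lemma derivable_slopeN_le f x v s c : derivable f (x + s *: v) v ->
  - c <= 'D_v f (x + s *: v) -> slope_le (fun t => - f (x + t *: v)) c s.
Proof.
move=> df dc.
have dN : derivable (- f) (x + s *: v) v by exact: derivableN.
by have := @derivable_slope_le (- f) x v s c dN; apply; rewrite deriveN//; lra.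
Qed.

Lemma derive_bound_increment f x v c (h : R) : 0 <= h ->
  (forall s, 0 <= s <= h -> derivable f (x + s *: v) v /\
     `|'D_v f (x + s *: v)| <= c) ->
  `|f (x + h *: v) - f x| <= c * h.
Proof.
move=> h0 H.
have := @slope_le_increment R (fun t => f (x + t *: v)) 0 h c h0.
have := @slope_le_increment R (fun t => - f (x + t *: v)) 0 h c h0.
rewrite scale0r addr0 subr0 => H1 H2.
apply/ler_normlP; split; [|apply: H2]; last first.
  by move=> s /H [df /ler_normlP[_ ?]]; exact: derivable_slope_le.
rewrite opprB addrC -[X in _ + X <= _]opprK; move: H1; rewrite opprK addrC; apply.
by move=> s /H [df /ler_normlP[? _]]; apply: derivable_slopeN_le => //; lra.
Qed.

End directional.

(** * Row vectors and continuously differentiable functions *)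

Section rows.
Context {R : realType} {n : nat}.
Implicit Types (x y z : 'rV[R]_n) (i : 'I_n) (c r h : R).

Lemma dotC x y : dot x y = dot y x.
Proof. by apply: eq_bigr => i _; rewrite mulrC. Qed.

Lemma dotDl x y z : dot (x + y) z = dot x z + dot y z.
Proof. by rewrite -big_split; apply: eq_bigr => i _; rewrite mxE mulrDl. Qed.

Lemma dotZl c x y : dot (c *: x) y = c * dot x y.
Proof. by rewrite /dot mulr_sumr; apply: eq_bigr => i _; rewrite mxE mulrA. Qed.

Lemma dotNl x y : dot (- x) y = - dot x y.
Proof. by rewrite -scaleN1r dotZl mulN1r. Qed.

Lemma dotBl x y z : dot (x - y) z = dot x z - dot y z.
Proof. by rewrite dotDl dotNl. Qed.

Lemma dotDr x y z : dot z (x + y) = dot z x + dot z y.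
Proof. by rewrite dotC dotDl !(dotC z). Qed.

Lemma dotZr c x y : dot x (c *: y) = c * dot x y.
Proof. by rewrite dotC dotZl (dotC x). Qed.

Lemma dotNr x y : dot x (- y) = - dot x y.
Proof. by rewrite dotC dotNl (dotC x). Qed.

Lemma dot_basis x i : dot x (basis_vec i) = x 0 i.
Proof.
rewrite /dot (bigD1 i)//= big1 ?addr0 => [|j ji]; rewrite !mxE !eqxx/=.
  by rewrite mulr1.
by rewrite (negPf ji) mulr0.
Qed.

Lemma dot_ge0 x : 0 <= dot x x.
Proof. by apply: sumr_ge0 => i _; rewrite -expr2 sqr_ge0. Qed.

Lemma coord_le_norm x i : `|x 0 i| <= `|x|.
Proof.
rewrite [`|x|]mx_normrE.
exact: (le_bigmax _ (fun ij : 'I_1 * 'I_n => `|x ij.1 ij.2|) (0, i)).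
Qed.

Lemma norm_le_coord x c : 0 <= c -> (forall i, `|x 0 i| <= c) -> `|x| <= c.
Proof.
move=> c0 xc; rewrite [`|x|]mx_normrE.
by apply/bigmax_leP; split => // -[j i] _ /=; rewrite (ord1 j).
Qed.

Lemma norm_lt_coord x c : 0 < c -> (forall i, `|x 0 i| < c) -> `|x| < c.
Proof.
move=> c0 xc; rewrite [`|x|]mx_normrE.
by apply/bigmax_ltP; split => // -[j i] _ /=; rewrite (ord1 j).
Qed.

Lemma norm_basis_le i : `|basis_vec i : 'rV[R]_n| <= 1.
Proof.
by apply: norm_le_coord => // j; rewrite mxE eqxx/= ger0_norm ?ler0n// lern1 leq_b1.
Qed.

Lemma sqr_norm_le_dot x : `|x| ^+ 2 <= dot x x.
Proof.
have h i : `|x 0 i| <= Num.sqrt (dot x x).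
  rewrite -sqrtr_sqr ler_sqrt ?dot_ge0// /dot (bigD1 i)//= -expr2 lerDl.
  by apply: sumr_ge0 => j _; rewrite -expr2 sqr_ge0.
rewrite -[leRHS]sqr_sqrtr ?dot_ge0// lerXn2r ?nnegrE ?sqrtr_ge0//.
by apply: norm_le_coord; rewrite ?sqrtr_ge0.
Qed.

Lemma norm_le_enorm x : `|x| <= enorm x.
Proof.
rewrite -ler_sqr ?nnegrE ?sqrtr_ge0// sqr_sqrtr ?dot_ge0//.
exact: sqr_norm_le_dot.
Qed.

Lemma norm_dot_le x y : `|dot x y| <= n%:R * (`|x| * `|y|).
Proof.
apply: le_trans (ler_norm_sum _ _ _) _.
rewrite -[n in n%:R]card_ord -sum1_card natr_sum mulr_suml.
by apply: ler_sum => i _; rewrite mul1r normrM ler_pM// coord_le_norm.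
Qed.

(** In the sup norm a ball is a box, so it contains the axis-parallel path
    joining two of its points that changes one coordinate after the other. *)
Lemma coordinatewise_lipschitz (g : 'rV[R]_n -> R) z0 r c : 0 <= c ->
  (forall z i h, ball z0 r z -> ball z0 r (z + h *: basis_vec i) ->
     `|g (z + h *: basis_vec i) - g z| <= c * `|h|) ->
  forall x y, ball z0 r x -> ball z0 r y ->
    `|g y - g x| <= n%:R * c * `|y - x|.
Proof.
move=> c0 gc x y xr yr.
pose mix k : 'rV[R]_n := \row_j if (j < k)%N then y 0 j else x 0 j.
have mixr k : ball z0 r (mix k).
  move: xr yr; rewrite -!ball_normE /= => xr yr.
  apply: norm_lt_coord => [|j]; first exact: le_lt_trans (normr_ge0 _) xr.
  rewrite !mxE; case: ifP => _.
    by apply: le_lt_trans yr; have := coord_le_norm (z0 - y) j; rewrite !mxE.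
  by apply: le_lt_trans xr; have := coord_le_norm (z0 - x) j; rewrite !mxE.
have step (k : 'I_n) : mix k.+1 = mix k + (y 0 k - x 0 k) *: basis_vec k.
  apply/rowP => j; rewrite !mxE eqxx/= ltnS leq_eqVlt -val_eqE /=.
  by case: eqVneq => /= [/val_inj ->|_]; rewrite ?ltnn ?mulr1 ?mulr0 ?addr0 ?subrKC.
have H k : (k <= n)%N -> `|g (mix k) - g x| <= k%:R * c * `|y - x|.
  elim: k => [_|k IH kn].
    rewrite (_ : mix 0%N = x) ?subrr ?normr0 ?mul0r//.
    by apply/rowP => j; rewrite mxE.
  have := IH (ltnW kn).
  have := gc (mix k) (Ordinal kn) (y 0 (Ordinal kn) - x 0 (Ordinal kn)) (mixr k).
  rewrite -(step (Ordinal kn)) => /(_ (mixr _)) h1 h2.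
  have h3 : `|y 0 (Ordinal kn) - x 0 (Ordinal kn)| <= `|y - x|.
    by have := coord_le_norm (y - x) (Ordinal kn); rewrite !mxE.
  rewrite -(subrKA (g (mix k))) -natr1 mulrDl mulrDl mul1r addrC.
  apply: le_trans (ler_normD _ _) _; apply: lerD h2 _.
  by apply: le_trans h1 _; rewrite ler_wpM2l.
have := H n (leqnn n); rewrite (_ : mix n = y)//.
by apply/rowP => j; rewrite mxE ltn_ord.
Qed.

End rows.

Section C1_functions.
Context {R : realType} {n : nat}.
Implicit Types (x v : 'rV[R]_n) (rho : 'rV[R]_n -> R).

(** Subtracting the linear part at [x] leaves a function with small partial
    derivatives near [x], hence a small Lipschitz constant there. *)
Lemma C1_increment rho x : (\forall y \near x, forall i, derivable rho y (basis_vec i)) ->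
  (forall i, {for x, continuous (fun y => 'D_(basis_vec i) rho y)}) ->
  forall v e, 0 < e -> exists2 d, 0 < d & forall h, 0 <= h < d ->
    `|rho (x + h *: v) - rho x - h * dot (grad rho x) v| <= e * h.
Proof.
move=> drho crho v e e0.
pose w := e / (n%:R * `|v| + 1).
have nv0 : 0 < n%:R * `|v| + 1 by rewrite ltr_wpDl// mulr_ge0.
have w0 : 0 < w by rewrite divr_gt0.
have [r r0 hr] : exists2 r, 0 < r & forall y, ball x r y -> forall i,
    derivable rho y (basis_vec i) /\
    `|'D_(basis_vec i) rho y - 'D_(basis_vec i) rho x| <= w.
  have near_D : \forall y \near x, forall i,
      `|'D_(basis_vec i) rho y - 'D_(basis_vec i) rho x| <= w.
    apply: (@filter_forall 'rV[R]_n 'I_n (fun i y =>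
      `|'D_(basis_vec i) rho y - 'D_(basis_vec i) rho x| <= w) (nbhs x) (nbhs_filter x)) => i.
    have /cvgrPdist_le/(_ w w0) := crho i.
    by apply: filterS => y; rewrite distrC.
  have : nbhs x (fun y => (forall i, derivable rho y (basis_vec i)) /\
    (forall i, `|'D_(basis_vec i) rho y - 'D_(basis_vec i) rho x| <= w)).
    exact: filterI.
  move=> /nbhs_ballP[r r0 hr].
  by exists r => // y /hr[dy Dy] i; split.
pose psi y := rho y - dot (grad rho x) y.
have psi_lip : forall y z, ball x r y -> ball x r z ->
    `|psi z - psi y| <= n%:R * w * `|z - y|.
  apply: coordinatewise_lipschitz (ltW w0) _ => z i h.
  wlog h0 : z h / 0 <= h => [hwlog|] rz rzh.
    case: (leP 0 h) => [|h0]; first by move=> ?; apply: hwlog.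
    have := hwlog (z + h *: basis_vec i) (- h).
    rewrite scaleNr addrK normrN distrC; apply => //.
    by rewrite oppr_ge0 ltW.
  rewrite (ger0_norm h0).
  have Dpsi y : derivable rho y (basis_vec i) ->
     is_derive y (basis_vec i) psi ('D_(basis_vec i) rho y - 'D_(basis_vec i) rho x).
    move=> dy.
    have dl : is_derive y (basis_vec i) (dot (grad rho x)) ('D_(basis_vec i) rho x).
      have E : (fun h : R => h^-1 *: ((dot (grad rho x) \o shift y) (h *: basis_vec i)
               - dot (grad rho x) y)) @ 0^' --> 'D_(basis_vec i) rho x.
        apply: cvg_near_cst; near=> k.
        rewrite /= dotDr addrK dotZr dot_basis /grad mxE [_ *: _]mulrA mulVf ?mul1r//.
        by near: k; exact: nbhs_dnbhs_neq.
      split; [by apply/cvg_ex; eexists; exact: E|exact: cvg_lim E].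
    exact: is_deriveB.
  apply: derive_bound_increment => // s /andP[s0 sh].
  have zs : ball x r (z + s *: basis_vec i).
    move: rz rzh; rewrite -!ball_normE /= => rz rzh.
    apply: norm_lt_coord => // j.
    have := le_lt_trans (coord_le_norm _ j) rzh.
    have := le_lt_trans (coord_le_norm _ j) rz.
    rewrite !mxE eqxx /= !ltr_norml; case: (j == i) => /=; lra.
  have [dy Dy] := hr _ zs i.
  have [dp ->] := Dpsi _ (dy); split => //.
have v1 : 0 < `|v| + 1 by rewrite ltr_wpDl.
exists (r / (`|v| + 1)); first by rewrite divr_gt0.
move=> h /andP[h0 hd].
have xh : ball x r (x + h *: v).
  rewrite -ball_normE /= opprD addrA subrr add0r normrN normrZ ger0_norm//.
  move: hd; rewrite ltr_pdivlMr// => hd; apply: le_lt_trans hd.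
  by rewrite ler_wpM2l// lerDl.
have := psi_lip x (x + h *: v) (ballxx x r0) xh.
have -> : psi (x + h *: v) - psi x = rho (x + h *: v) - rho x - h * dot (grad rho x) v.
  by rewrite /psi dotDr dotZr; ring.
have -> : x + h *: v - x = h *: v by rewrite addrC addKr.
move=> H; apply: le_trans H _.
rewrite normrZ ger0_norm//.
have -> : n%:R * w * (h * `|v|) = w * (n%:R * `|v|) * h by ring.
rewrite ler_wpM2r//.
have -> : e = w * (n%:R * `|v| + 1) by rewrite /w divfK// gt_eqF.
by rewrite ler_wpM2l ?(ltW w0)// lerDl.
Unshelve. all: by end_near. Qed.

End C1_functions.

(** * The outward normal of a convex domain *)

Section convex_domains.
Context {R : realType} {n : nat}.
Implicit Types (Om : set 'rV[R]_n) (x y z v nu : 'rV[R]_n).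

Lemma convex_domain_segment Om x y l : convex_domain Om -> Om x -> Om y ->
  0 <= l <= 1 -> Om (x + l *: (y - x)).
Proof.
move=> cOm Omx Omy /andP[l0 l1].
have := cOm y x (Itv01 l0 l1); rewrite !inE => /(_ Omy Omx).
rewrite /conv/= => H; suff -> : x + l *: (y - x) = l *: y + (1 - l) *: x by [].
by apply/rowP => i; rewrite !mxE; ring.
Qed.

Lemma closure_ball Om x : closure Om x -> forall e, 0 < e ->
  exists2 y, Om y & `|x - y| < e.
Proof.
move=> cx e e0; have [y [Omy]] := cx _ (nbhsx_ballx x e e0).
by rewrite -ball_normE /=; exists y.
Qed.

Lemma open_ball Om x : open Om -> Om x -> exists2 r, 0 < r &
  forall y, `|x - y| < r -> Om y.
Proof.
move=> oOm Omx; have /nbhs_ballP[r /= r0 hr] : nbhs x Om by exact: open_nbhs_nbhs.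
by exists r => // y xy; apply: hr; rewrite -ball_normE.
Qed.

(** A point of [Om] near [x], joined to a slightly moved copy of [z], gives a
    segment of [Om] through the same intermediate point. *)
Lemma convex_domain_closure_segment Om x z l : open Om -> convex_domain Om ->
  closure Om x -> Om z -> 0 < l <= 1 -> Om (x + l *: (z - x)).
Proof.
move=> oOm cOm cx Omz /andP[l0 l1].
have [r r0 hr] := open_ball oOm Omz.
have [y Omy xy] := closure_ball cx (mulr_gt0 l0 r0).
pose z' := z + ((1 - l) / l) *: (x - y).
have Omz' : Om z'.
  apply: hr; rewrite /z' opprD addrA subrr add0r normrN normrZ ger0_norm; last first.
    by rewrite divr_ge0 ?subr_ge0// ltW.
  rewrite mulrAC ltr_pdivrMr// (mulrC r).
  by apply: le_lt_trans xy; rewrite ler_piMl// lerBlDr lerDl ltW.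
have -> : x + l *: (z - x) = y + l *: (z' - y).
  apply/rowP => i; rewrite /z' !mxE.
  by field; rewrite gt_eqF.
by apply: convex_domain_segment; rewrite ?(ltW l0).
Qed.

Lemma closure_frontierP Om x : open Om -> closure Om x -> Om x \/ frontier Om x.
Proof.
move=> oOm cx; have [|nx] := pselect (Om x); [by left|right].
by split => // /interior_subset.
Qed.

Lemma frontier_notin Om x : open Om -> frontier Om x -> ~ Om x.
Proof. by move=> oOm [_] + Omx; apply; rewrite (interior_id Om).1. Qed.

Lemma enorm_sqr x : enorm x ^+ 2 = dot x x.
Proof. by rewrite sqr_sqrtr// dot_ge0. Qed.

Lemma enorm_gt0 x : x != 0 -> 0 < enorm x.
Proof. by move=> x0; apply: lt_le_trans (norm_le_enorm x); rewrite normr_gt0. Qed.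

Section boundary_point.
Variables (Om : set 'rV[R]_n) (x nu : 'rV[R]_n).
Hypotheses (oOm : open Om) (cOm : convex_domain Om) (Om0 : Om !=set0).
Hypotheses (fx : frontier Om x) (nu_normal : outward_unit_normal Om x nu).

(** The defining function vanishes at [x]: it is nonnegative outside [Om], and
    along a segment from [x] into [Om] it is negative and continuous. *)
Let defining : exists rho, [/\ rho x = 0, 0 < enorm (grad rho x),
    nu = (enorm (grad rho x))^-1 *: grad rho x,
    exists2 r, 0 < r & forall y, `|x - y| < r -> Om y <-> rho y < 0 &
    forall v e, 0 < e -> exists2 d, 0 < d & forall h, 0 <= h < d ->
     `|rho (x + h *: v) - rho x - h * dot (grad rho x) v| <= e * h].
Proof.
have [rho [U [oU Ux] [sm g0 HU]] ->] := nu_normal.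
have [_ C1rho] := sm 1%N.
have incr v e : 0 < e -> exists2 d, 0 < d & forall h, 0 <= h < d ->
     `|rho (x + h *: v) - rho x - h * dot (grad rho x) v| <= e * h.
  apply: C1_increment; last by move=> i; have [_ [cD _]] := C1rho i; exact: cD.
  have Un : nbhs x U by exact: open_nbhs_nbhs.
  by apply: filterS Un => y Uy i; have [dU _] := C1rho i; exact: dU.
have [r r0 hr] := open_ball oU Ux.
exists rho; split => //; [|exact: enorm_gt0|by exists r => // y /hr; exact: HU].
apply/le_anti/andP; split; last first.
  by rewrite leNgt; apply/negP => /(HU _ Ux); exact: frontier_notin fx.
have [z Omz] := Om0; pose v := z - x.
apply/ler_addgt0Pr => e e0; rewrite add0r.
have [d d0 hd] := incr v 1 ltr01.
pose A := 1 + `|dot (grad rho x) v|.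
have A0 : 0 < A by rewrite ltr_wpDr.
pose h := Num.min (Num.min (d / 2) 1) (Num.min (r / (2 * (`|v| + 1))) (e / A)).
have v1 : 0 < `|v| + 1 by rewrite ltr_wpDl.
have h0 : 0 < h by rewrite !lt_min ltr01 !divr_gt0 ?mulr_gt0 ?ltr0n.
have h_d : h < d.
  have : h <= d / 2 by rewrite /h !ge_min lexx.
  lra.
have h1 : h <= 1 by rewrite /h !ge_min lexx !orbT.
have hA : h * A <= e by rewrite -ler_pdivlMr// /h !ge_min lexx !orbT.
have hv : h * `|v| < r.
  have : h <= r / (2 * (`|v| + 1)) by rewrite /h !ge_min lexx !orbT.
  rewrite ler_pdivlMr ?mulr_gt0// => H; have : 0 <= h * `|v| by rewrite mulr_ge0// ltW.
  lra.
have Ov : Om (x + h *: v).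
  by apply: convex_domain_closure_segment; rewrite ?h0// ; case: fx.
have : rho (x + h *: v) < 0.
  apply/HU => //; apply: hr.
  by rewrite opprD addrA subrr add0r normrN normrZ gtr0_norm.
have := hd h; rewrite (ltW h0) h_d => /(_ isT) /ler_normlP[+ _].
have : - (h * dot (grad rho x) v) <= h * `|dot (grad rho x) v|.
  by rewrite -mulrN ler_wpM2l ?(ltW h0)// -normrN ler_norm.
move: hA; rewrite /A; lra.
Qed.

Lemma unit_normal_dot : dot nu nu = 1.
Proof.
have [rho [_ G0 -> _ _]] := defining.
by rewrite dotZl dotZr -enorm_sqr expr2 mulKf ?mulVf ?gt_eqF.
Qed.

(** The defining function is negative along the segment from [x] to [z], so its
    derivative in that direction is nonpositive; moving [z] a little along [nu]
    inside the open set [Om] makes the inequality strict. *)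
Lemma normal_separates z : Om z -> dot (z - x) nu < 0.
Proof.
have sep y : Om y -> dot (y - x) nu <= 0.
  move=> Omy; have [rho [r0 G0 nuE [r rp hr] incr]] := defining.
  rewrite nuE dotZr; apply: mulr_ge0_le0; first by rewrite invr_ge0 ltW.
  rewrite dotC; apply/ler_addgt0Pr => e e0; rewrite add0r.
  pose v := y - x; have [d d0 hd] := incr v e e0.
  have v1 : 0 < `|v| + 1 by rewrite ltr_wpDl.
  pose h := Num.min (Num.min (d / 2) 1) (r / (2 * (`|v| + 1))).
  have h0 : 0 < h by rewrite !lt_min ltr01 !divr_gt0 ?mulr_gt0 ?ltr0n.
  have h_d : h < d.
  have : h <= d / 2 by rewrite /h !ge_min lexx.
  lra.
  have h1 : h <= 1 by rewrite /h !ge_min lexx !orbT.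
  have hv : h * `|v| < r.
    have : h <= r / (2 * (`|v| + 1)) by rewrite /h !ge_min lexx !orbT.
    rewrite ler_pdivlMr ?mulr_gt0// => H; have : 0 <= h * `|v| by rewrite mulr_ge0// ltW.
    lra.
  have Ov : Om (x + h *: v).
    by apply: convex_domain_closure_segment; rewrite ?h0// ; case: fx.
  have : rho (x + h *: v) < 0.
    by apply/hr => //; rewrite opprD addrA subrr add0r normrN normrZ gtr0_norm.
  have := hd h; rewrite (ltW h0) h_d => /(_ isT) /ler_normlP[+ _].
  rewrite r0 => H1 H2; rewrite -(ler_pM2l h0); lra.
move=> Omz; have [r r0 hr] := open_ball oOm Omz.
have nu1 : 0 < `|nu| + 1 by rewrite ltr_wpDl.
pose k := r / (2 * (`|nu| + 1)).
have k0 : 0 < k by rewrite divr_gt0 ?mulr_gt0.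
have := sep (z + k *: nu).
have -> : dot (z + k *: nu - x) nu = dot (z - x) nu + k.
  by rewrite !dotDl dotZl unit_normal_dot; ring.
suff Ok : Om (z + k *: nu) by move=> /(_ Ok); lra.
apply: hr; rewrite opprD addrA subrr add0r normrN normrZ gtr0_norm//.
have : k * (2 * (`|nu| + 1)) = r by rewrite divfK// gt_eqF// mulr_gt0.
have : 0 <= k * `|nu| by rewrite mulr_ge0// ltW.
lra.
Qed.

Lemma inward_segment : exists2 d, 0 < d & forall h, 0 < h < d -> Om (x - h *: nu).
Proof.
have [rho [rx G0 nuE [r rp hr] incr]] := defining.
have [d d0 hd] := incr (- nu) (enorm (grad rho x) / 2) ltac:(lra).
have nu1 : 0 < `|nu| + 1 by rewrite ltr_wpDl.
exists (Num.min d (r / (`|nu| + 1))); first by rewrite lt_min d0 divr_gt0.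
move=> h /andP[h0]; rewrite lt_min ltr_pdivlMr// => /andP[h_d hnu].
apply/hr.
  rewrite opprB addrCA subrr addr0 normrZ gtr0_norm//.
  by apply: le_lt_trans hnu; rewrite ler_wpM2l ?(ltW h0)// lerDl.
have := hd h; rewrite (ltW h0) h_d scalerN => /(_ isT) /ler_normlP[_].
have Gnu : dot (grad rho x) nu = enorm (grad rho x).
  by rewrite nuE dotZr -enorm_sqr expr2 mulKf ?gt_eqF.
rewrite rx dotNr Gnu.
have := mulr_gt0 h0 G0; lra.
Qed.

End boundary_point.

Lemma normal_separates_closure Om x nu y : open Om -> convex_domain Om ->
  Om !=set0 -> frontier Om x -> outward_unit_normal Om x nu ->
  closure Om y -> dot (y - x) nu <= 0.
Proof.
move=> oOm cOm Om0 fx nux cy; apply/ler_addgt0Pr => e e0; rewrite add0r.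
have A0 : 0 < n%:R * (`|nu| + 1) + 1 :> R by rewrite ltr_wpDl// mulr_ge0// addr_ge0.
have [z Omz yz] := closure_ball cy (divr_gt0 e0 A0).
have zx := normal_separates oOm cOm Om0 fx nux Omz.
have -> : y - x = (z - x) + (y - z) by rewrite [RHS]addrC subrKA.
rewrite dotDl.
have := norm_dot_le (y - z) nu; move=> /ler_normlP[_ H].
suff : n%:R * (`|y - z| * `|nu|) <= e.
  by move=> H1; lra.
move: yz; rewrite ltr_pdivlMr// => yz; apply: le_trans (ltW yz).
rewrite mulrCA ler_wpM2l//.
have : 0 <= n%:R :> R by []. lra.
Qed.

End convex_domains.

(** * One-dimensional measure arguments *)

Section measure_of_line.
Context {R : realType}.
Local Notation mu := (@lebesgue_measure R).

(** Replacing [g s] by [g s - C * mu (U `&` ]a - 1, s])] costs at most [C * E]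
    over the interval, and it makes the slope at most [c] also at the points of
    the exceptional open set [U]. *)
Lemma slope_le_outside_increment (g : R -> R) (a b c C E : R) (U : set R) :
  a <= b -> open U -> (mu U <= E%:E)%E -> 0 <= c -> 0 <= C ->
  (forall s, a <= s <= b -> slope_le g C s) ->
  (forall s, a <= s <= b -> U s \/ slope_le g c s) ->
  g b - g a <= c * (b - a) + C * E.
Proof.
move=> ab oU muU c0 C0 gC gc.
have mU : measurable U by exact: open_measurable.
pose m s := fine (mu (U `&` `]a - 1, s])).
have muv (u v : R) : u <= v -> mu `]u, v]%classic = (v - u)%:E.
  move=> uv; apply: etrans (lebesgue_measure_itv `]u, v]) _.
  rewrite /= lte_fin; case: ltP => // vu.
  by rewrite (le_anti (introT andP (conj uv vu))) subrr.
have fin u v : u <= v -> mu (U `&` `]u, v]) \is a fin_num.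
  move=> uv; rewrite ge0_fin_numE ?measure_ge0//.
  apply: (@le_lt_trans _ _ (mu `]u, v]%classic)); last by rewrite muv// ltry.
  by apply: le_measure; rewrite ?inE//; exact: measurableI.
have mD u v : a - 1 <= u -> u <= v -> m v = m u + fine (mu (U `&` `]u, v])).
  move=> au uv; rewrite /m -fineD ?fin// -measureU//; first last.
  - apply/seteqP; split => // x [[_ /=]]; rewrite !in_itv /= => /andP[_ xu] [_].
    by move=> /andP[ux _]; move: (lt_le_trans ux xu); rewrite ltxx.
  - exact: measurableI.
  - exact: measurableI.
  congr (fine (mu _)); rewrite -setIUr; congr (_ `&` _).
  apply/seteqP; split => x /=; rewrite !in_itv /=.
    move=> /andP[ax xv]; case: (leP x u) => xu; [left|right]; rewrite ?ax ?xu ?xv //.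
  move=> [/andP[ax xu]|/andP[ux xv]]; first by rewrite ax (le_trans xu).
  by rewrite (le_lt_trans au) ?ux.
have m_incr u v : a - 1 <= u -> u <= v -> m u <= m v.
  by move=> au uv; rewrite (mD u v)// lerDl fine_ge0// measure_ge0.
have mE : m b - m a <= E.
  rewrite (mD a b)//; last lra.
  rewrite addrAC subrr add0r -lee_fin fineK ?fin//; apply: le_trans muU.
  by apply: le_measure; rewrite ?inE//; exact: measurableI.
have := @slope_le_increment R (fun s => g s - C * m s) a b c ab.
suff H : forall s, a <= s <= b -> slope_le (fun s => g s - C * m s) c s.
  move=> /(_ H); have := ler_wpM2l C0 mE; lra.
move=> s sab; have /andP[as_ sb] := sab; case: (gc s sab) => [Us|gs] e e0.
  have [r1 r10 h1] := gC s sab e e0.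
  have /nbhs_ballP[r2 /= r20 h2] : nbhs s U by exact: open_nbhs_nbhs.
  exists (Num.min (Num.min r1 r2) 1); first by rewrite !lt_min r10 r20 ltr01.
  move=> u v su us sv vs.
  have ru : s - r1 < u.
    by apply: le_lt_trans su; rewrite lerB// !ge_min lexx.
  have rv : v < s + r1.
    by apply: (lt_le_trans vs); rewrite lerD2l// !ge_min lexx.
  have ru2 : s - r2 < u.
    by apply: le_lt_trans su; rewrite lerB// !ge_min lexx orbT.
  have rv2 : v < s + r2.
    by apply: (lt_le_trans vs); rewrite lerD2l// !ge_min lexx orbT.
  have u1 : a - 1 <= u.
    apply: le_trans (ltW su); rewrite lerB// !ge_min lexx ?orbT//.
  have uv := le_trans us sv.
  have -> : m v = m u + (v - u).
    rewrite (mD u v)// (_ : U `&` _ = `]u, v]%classic) ?muv//.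
    apply/seteqP; split=> [x []//|x /= uxv]; split => //; apply: h2.
    move: uxv; rewrite in_itv /= => /andP[ux xv].
    by rewrite -ball_normE /= ltr_norml; apply/andP; split; lra.
  have := h1 u v ru us sv rv.
  have := mulr_ge0 c0 (_ : 0 <= v - u); rewrite subr_ge0 => /(_ uv); lra.
have [r1 r10 h1] := gs e e0.
exists (Num.min r1 1); first by rewrite lt_min r10 ltr01.
move=> u v su us sv vs.
have ru : s - r1 < u by apply: le_lt_trans su; rewrite lerB// ge_min lexx.
have rv : v < s + r1 by apply: (lt_le_trans vs); rewrite lerD2l// ge_min lexx.
have u1 : a - 1 <= u.
  by apply: le_trans (ltW su); rewrite lerB// ge_min lexx orbT.
have := h1 u v ru us sv rv.
have := ler_wpM2l C0 (m_incr u v u1 (le_trans us sv)); lra.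
Qed.

(** Markov's inequality for [z |-> \sum_k w k * (a k <= z <= b k)], whose
    integral is at most [E]. *)
Lemma averaging_point (a b w : nat -> R) (x r E : R) : 0 < r -> 0 < E ->
  (forall k, a k <= b k) -> (forall k, 0 <= w k) ->
  (\sum_(0 <= k <oo) (w k * (b k - a k))%:E <= E%:E)%E ->
  exists2 z, x <= z <= x + r &
    (\sum_(0 <= k <oo) (w k * (z \in `[a k, b k])%:R)%:E <= (E * (2 / r))%:E)%E.
Proof.
move=> r0 E0 ab w0 sumE; apply: contrapT => nz.
pose D : set R := `[x, x + r]%classic.
pose f k (z : R) : \bar R := ((w k)%:E * (\1_(`[a k, b k]%classic) z)%:E)%E.
have fE k z : f k z = (w k * (z \in `[a k, b k])%:R)%:E.
  by rewrite /f -EFinM indicE mem_setE.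
have mD : measurable D by exact: measurable_itv.
have f0 k z : (0 <= f k z)%E by rewrite fE lee_fin mulr_ge0.
have mf k : measurable_fun D (f k).
  apply: measurable_funeM; apply/measurable_EFinP.
  exact: measurable_indic.
have H1 : (\int[mu]_(z in D) (\sum_(0 <= k <oo) f k z) <= E%:E)%E.
  rewrite integral_nneseries//; apply: le_trans sumE.
  apply: lee_nneseries => [k _ _|k _].
    by apply: integral_ge0 => z _; exact: f0.
  rewrite /f ge0_integralZl_EFin//; last first.
    by apply/measurable_EFinP; exact: measurable_indic.
  rewrite integral_indic// EFinM lee_wpmul2l ?lee_fin//.
  apply: (@le_trans _ _ (mu `[a k, b k]%classic)).
    by apply: le_measure; rewrite ?inE//; exact: measurableI.
  have -> : mu `[a k, b k]%classic = (if (a k < b k)%O then (b k - a k)%:E else 0%E).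
    by apply: etrans (lebesgue_measure_itv `[a k, b k]) _; rewrite /= lte_fin.
  by case: ifP => // _; rewrite lee_fin subr_ge0.
have H2 : ((E * (2 / r))%:E * mu D <= \int[mu]_(z in D) (\sum_(0 <= k <oo) f k z))%E.
  rewrite -integral_cst//; apply: ge0_le_integral => //.
  - by move=> z _; rewrite /cst lee_fin mulr_ge0 ?divr_ge0// ltW.
  - by apply: (@ge0_emeasurable_sum _ _ _ D f xpredT).
  move=> z Dz; rewrite /cst leNgt; apply/negP => zlt; apply: nz; exists z.
    by move: Dz; rewrite /D /= in_itv.
  by apply: le_trans (ltW zlt); apply: lee_nneseries => [k _ _|k _]; rewrite ?fE// lee_fin mulr_ge0.
have muD : mu D = r%:E.
  apply: etrans (lebesgue_measure_itv `[x, x + r]) _.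
  by rewrite /= lte_fin ltrDl r0 -EFinD addrAC subrr add0r.
have := le_trans H2 H1; rewrite muD.
rewrite -EFinM lee_fin -!mulrA mulVf ?gt_eqF// mulr1.
lra.
Qed.

End measure_of_line.

(** * Lines that almost avoid a null set *)

Section null_sets_and_lines.
Context {R : realType}.
Local Notation mu := (@lebesgue_measure R).

(** The coordinates in [s] are fixed one at a time: fixing one of them replaces
    the side lengths of the boxes by indicators and costs a factor [2 / r]. *)
Lemma transverse_selection (I : eqType) (a b : nat -> I -> R) (s : seq I)
    (r : R) (x : I -> R) : 0 < r -> uniq s -> (forall k j, a k j <= b k j) ->
  forall (w : nat -> R) E, 0 < E -> (forall k, 0 <= w k) ->
  (\sum_(0 <= k <oo) (w k * \prod_(j <- s) (b k j - a k j))%:E <= E%:E)%E ->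
  exists2 z : I -> R, forall j, x j <= z j <= x j + r &
  (\sum_(0 <= k <oo) (w k * \prod_(j <- s) (z j \in `[a k j, b k j])%:R)%:E
    <= (E * (2 / r) ^+ size s)%:E)%E.
Proof.
move=> r0 + ab; elim: s => [_|j s IH /= /andP[js us]] w E E0 w0 sumE.
  exists x => [j|]; first by rewrite lexx lerDl ltW.
  rewrite expr0 mulr1; apply: le_trans sumE; rewrite le_eqVlt; apply/orP; left.
  by apply/eqP; apply: eq_eseriesr => k _; rewrite !big_nil.
have prod_ge0 k : 0 <= \prod_(j <- s) (b k j - a k j).
  by apply: prodr_ge0 => i _; rewrite subr_ge0.
have [||zj xzj sumj] := @averaging_point R (a^~ j) (b^~ j)
    (fun k => w k * \prod_(j <- s) (b k j - a k j)) (x j) r E r0 E0 (ab^~ j).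
- by move=> k; rewrite mulr_ge0.
- apply: le_trans sumE; rewrite le_eqVlt; apply/orP; left; apply/eqP.
  by apply: eq_eseriesr => k _; rewrite big_cons mulrAC mulrA.
have [|||z xz sumz] := IH us (fun k => w k * (zj \in `[a k j, b k j])%:R) (E * (2 / r)).
- by rewrite mulr_gt0// divr_gt0.
- by move=> k; rewrite mulr_ge0.
- apply: le_trans sumj; rewrite le_eqVlt; apply/orP; left; apply/eqP.
  by apply: eq_eseriesr => k _; rewrite mulrAC.
exists (fun i => if i == j then zj else z i) => [i|].
  by case: eqP => [->|_]; [exact: xzj|exact: xz].
rewrite exprS mulrA; apply: le_trans sumz; rewrite le_eqVlt; apply/orP; left; apply/eqP.
apply: eq_eseriesr => k _; rewrite big_cons eqxx mulrA; congr (_ * _)%:E.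
apply: eq_big_seq => i is_; case: eqP => // ij; by rewrite ij (negPf js) in is_.
Qed.

(** By Fubini for boxes, some line parallel to the [i]-th axis and close to any
    prescribed one meets a null set in a set of small length. *)
Lemma null_set_line n (N : set ('rV[R]_n * R)) (x : 'rV[R]_n) (t : R) (i : 'I_n)
    (r E : R) : lebesgue_null N -> 0 < r -> 0 < E ->
  exists (z : 'rV[R]_n) (t' : R) (U : set R),
  [/\ forall j, x 0 j <= z 0 j <= x 0 j + r, t <= t' <= t + r,
      open U, (mu U <= E%:E)%E &
      forall s, N (z + s *: basis_vec i, t') -> U s].
Proof.
move=> N0 r0 E0.
pose I := option 'I_n.
(* [None] stands for the time coordinate; only coordinate [i] is left free *)
pose s : seq I := None :: [seq Some j | j <- enum 'I_n & j != i].
have us : uniq s.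
  rewrite cons_uniq map_inj_uniq; last by move=> ? ? [].
  by rewrite filter_uniq ?enum_uniq// andbT; apply/mapP => -[].
pose E' := E / 2 / (2 / r) ^+ size s.
have E'0 : 0 < E' by rewrite !divr_gt0// exprn_gt0// divr_gt0.
have [a [b [ab Nab sumab]]] := N0 _ E'0.
pose co (p : 'rV[R]_n * R) (j : I) := if j is Some j then p.1 0 j else p.2.
have coab k j : co (a k) j <= co (b k) j.
  by have [H1 H2] := ab k; case: j => [j|]; [exact: H1|exact: H2].
have [||z xz sumz] := @transverse_selection I (fun k => co (a k)) (fun k => co (b k))
    s r (co (x, t)) r0 us coab
    (fun k => co (b k) (Some i) - co (a k) (Some i)) E' E'0.
- by move=> k; rewrite subr_ge0.
- apply: le_trans sumab; rewrite le_eqVlt; apply/orP; left; apply/eqP.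
  apply: eq_eseriesr => k _; congr (_%:E).
  rewrite /box_volume big_cons big_map big_filter big_enum_cond/= [in RHS](bigD1 i)//=.
  by rewrite mulrA mulrAC.
pose zv : 'rV[R]_n := \row_j (if j == i then x 0 i else z (Some j)).
pose D k : set R := if all (fun j => z j \in `[co (a k) j, co (b k) j]) s
  then `[co (a k) (Some i) - x 0 i, co (b k) (Some i) - x 0 i]%classic else set0.
have mD k : measurable (D k).
  by rewrite /D; case: ifP => _; [exact: measurable_itv|exact: measurable0].
pose DD := \bigcup_k D k.
have mDD : measurable DD by exact: bigcupT_measurable.
have muDD : (mu DD <= (E / 2)%:E)%E.
  apply: (@le_trans _ _ (\sum_(0 <= k <oo) mu (D k))%E).
    exact: measure_sigma_subadditive.
  have -> : E / 2 = E' * (2 / r) ^+ size s.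
    by rewrite /E' divfK// expf_neq0// gt_eqF// divr_gt0.
  apply: le_trans sumz; apply: lee_nneseries => [k _ _|k _]; first exact: measure_ge0.
  rewrite /D; case: ifPn => [/allP Hall|_].
    have -> : \prod_(j <- s) (z j \in `[co (a k) j, co (b k) j])%:R = 1 :> R.
      by rewrite big1_seq// => j /andP[_ /Hall ->].
    set l := co (b k) _; set m := co (a k) _.
    have -> : mu `[m - x 0 i, l - x 0 i]%classic =
        (if (m - x 0 i < l - x 0 i)%O then (l - x 0 i - (m - x 0 i))%:E else 0%E).
      by apply: etrans (lebesgue_measure_itv `[m - x 0 i, l - x 0 i]) _; rewrite /= lte_fin.
    have ml : m <= l by exact: coab.
    by case: ifP => _; rewrite lee_fin; lra.
  by rewrite measure0 lee_fin mulr_ge0 ?subr_ge0// prodr_ge0.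
have [||U [oU DU muU]] := @lebesgue_regularity_outer R DD (E / 2) mDD.
- by apply: le_lt_trans muDD _; rewrite ltry.
- by rewrite divr_gt0.
exists zv, (z None), U; split => //.
- move=> j; rewrite mxE; case: eqP => [->|_]; first by rewrite lexx lerDl ltW.
  exact: (xz (Some j)).
- exact: (xz None).
- have mU : measurable U by exact: open_measurable.
  have -> : U = DD `|` (U `\` DD).
    by rewrite setDE setUIr setUCr setIT; apply/esym/setUidr.
  rewrite measureU//; [|exact: measurableD|by rewrite setDE setICA setICr setI0].
  by have := leeD muDD (ltW muU); rewrite -EFinD -splitr.
move=> u /Nab [k _ [/= kx kt]]; apply: DU; exists k => //.
have -> : D k = `[co (a k) (Some i) - x 0 i, co (b k) (Some i) - x 0 i]%classic.
  rewrite /D ifT//; apply/allP => j; rewrite inE => /orP[/eqP ->|/mapP[l]].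
    by rewrite in_itv.
  rewrite mem_filter => /andP[li _] ->; rewrite in_itv /=.
  by have := kx l; rewrite !mxE (negPf li) andbF mulr0 addr0.
have := kx i; rewrite !mxE !eqxx /= mulr1 in_itv /=; lra.
Qed.

End null_sets_and_lines.

(** * Essential gradient bounds are Lipschitz bounds *)

Lemma lipschitz_constant {R : realType} {V : normedModType R} (A : set V) (g : V -> R) :
  [lipschitz g x | x in A] -> exists2 C, 0 < C &
    forall x y, A x -> A y -> `|g x - g y| <= C * `|x - y|.
Proof.
move=> [M [Mreal HM]]; exists (`|M| + 1) => [|x y Ax Ay].
  by rewrite ltr_wpDl.
have := HM (`|M| + 1); rewrite (le_lt_trans (ler_norm M)) ?ltrDl// => /(_ isT).
by move=> /(_ (x, y)) /=; apply.
Qed.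

Section gradient_bound.
Context {R : realType} {n : nat}.
Implicit Types (Om : set 'rV[R]_n) (v : 'rV[R]_n * R -> R) (x y : 'rV[R]_n) (c C T : R).

Lemma norm_pair_le (x : 'rV[R]_n) (t c : R) : `|x| <= c -> `|t| <= c -> `|(x, t)| <= c.
Proof. by move=> xc tc; rewrite prod_normE /= ge_max xc tc. Qed.

Lemma grad_length_le v p c : (`|grad_length v p| <= c%:E)%E ->
  forall i, derivable (fun y => v (y, p.2)) p.1 (basis_vec i) /\
    `|'D_(basis_vec i) (fun y => v (y, p.2)) p.1| <= c.
Proof.
rewrite /grad_length; case: asboolP => [dv|//] /=.
rewrite lee_fin ger0_norm ?sqrtr_ge0// => gc i; split; first exact: diff_derivable.
have := coord_le_norm (Dx v p) i; rewrite /Dx mxE => H.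
exact: le_trans H (le_trans (norm_le_enorm _) gc).
Qed.

(** The increment is compared with the one on a nearby parallel segment that
    almost avoids the exceptional set; the Lipschitz constant [C] controls both
    the displacement and the length of the exceptional part, and disappears as
    [rho] tends to zero. *)
Lemma grad_bound_coordinate Om T v (C c : R) (x0 x : 'rV[R]_n) r i h t : 0 <= c -> 0 < C ->
  (forall p q, cylinder Om T p -> cylinder Om T q -> `|v p - v q| <= C * `|p - q|) ->
  lebesgue_null (cylinder Om T `&` [set p | ~ (`|grad_length v p| <= c%:E)%E]) ->
  ball x0 r `<=` Om -> ball x0 r x -> ball x0 r (x + h *: basis_vec i) ->
  0 <= h -> 0 < t < T ->
  `|v (x + h *: basis_vec i, t) - v (x, t)| <= c * h.
Proof.
move=> c0 C0 vC vN xrOm xr xhr h0 /andP[t0 tT].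
have Cn : 0 < 3 * C + 1 by lra.
apply/ler_addgt0Pr => e e0.
pose m := Num.max `|x0 - x| `|x0 - (x + h *: basis_vec i)|.
have mr : m < r by move: xr xhr; rewrite -!ball_normE /= gt_max => -> ->.
pose rho := Num.min (Num.min ((r - m) / 2) ((T - t) / 2)) (e / (3 * C + 1)).
have rho0 : 0 < rho by rewrite !lt_min !divr_gt0 ?subr_gt0.
have rho_m : rho <= (r - m) / 2 by rewrite !ge_min lexx.
have rho_t : rho <= (T - t) / 2 by rewrite !ge_min lexx ?orbT.
have rho_e : rho * (3 * C + 1) <= e by rewrite -ler_pdivlMr// ge_min lexx orbT.
have [z [t' [U [xz /andP[tt' t't] oU muU NU]]]] := null_set_line x t i vN rho0 rho0.
have t'T : 0 < t' < T by apply/andP; split; lra.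
have zball s : 0 <= s <= h -> ball x0 r (z + s *: basis_vec i).
  move=> /andP[s0 sh]; rewrite -ball_normE /=.
  apply: norm_lt_coord => [|j].
    by apply: le_lt_trans (normr_ge0 (x0 - x)) _; move: mr; rewrite gt_max => /andP[].
  have := coord_le_norm (x0 - x) j; have := coord_le_norm (x0 - (x + h *: basis_vec i)) j.
  have : `|x0 - x| <= m by rewrite le_max lexx.
  have : `|x0 - (x + h *: basis_vec i)| <= m by rewrite le_max lexx orbT.
  move: (`|x0 - x|) (`|x0 - (x + h *: basis_vec i)|) => A B BA AA.
  have /andP[z1 z2] := xz j.
  rewrite !mxE eqxx /= !ler_norml ltr_norml; case: (j == i) => /=; lra.
have zcyl s : 0 <= s <= h -> cylinder Om T (z + s *: basis_vec i, t').
  by move=> sh; split => /=; [exact/xrOm/zball|rewrite in_itv].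
pose g s := v (z + s *: basis_vec i, t').
have lipg s : 0 <= s <= h -> exists2 d, 0 < d & forall u w, s - d < u -> u <= s ->
    s <= w -> w < s + d -> `|g w - g u| <= C * (w - u).
  move=> sh; have := zball s sh; rewrite -ball_normE /= => zs.
  exists (r - `|x0 - (z + s *: basis_vec i)|); first by rewrite subr_gt0.
  have near_s u : `|u - s| < r - `|x0 - (z + s *: basis_vec i)| ->
      cylinder Om T (z + u *: basis_vec i, t').
    move=> us; split => /=; last by rewrite in_itv.
    apply: xrOm; rewrite -ball_normE /=.
    have -> : x0 - (z + u *: basis_vec i) =
       x0 - (z + s *: basis_vec i) - (u - s) *: basis_vec i.
      by apply/rowP => j; rewrite !mxE; ring.
    apply: le_lt_trans (ler_normB _ _) _; rewrite addrC normrZ -ltrBrDr.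
    apply: le_lt_trans us; rewrite -[leRHS]mulr1 ler_wpM2l//; exact: norm_basis_le.
  move=> u w su us sw ws.
  apply: le_trans (vC _ _ _ _) _.
  - by apply: near_s; rewrite ger0_norm ?subr_ge0//; lra.
  - by apply: near_s; rewrite ler0_norm ?subr_le0//; lra.
  rewrite ler_pM2l//; apply: norm_pair_le => /=; last by rewrite subrr normr0; lra.
  have -> : z + w *: basis_vec i - (z + u *: basis_vec i) = (w - u) *: basis_vec i.
    by rewrite scalerBl opprD addrACA subrr add0r.
  rewrite normrZ ger0_norm; last lra.
  by rewrite -[leRHS]mulr1 ler_wpM2l ?norm_basis_le//; lra.
have g_incr : `|g h - g 0| <= c * h + C * rho.
  have good s : 0 <= s <= h -> ~ U s ->
      derivable (fun y => v (y, t')) (z + s *: basis_vec i) (basis_vec i) /\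
      `|'D_(basis_vec i) (fun y => v (y, t')) (z + s *: basis_vec i)| <= c.
    move=> sh nUs; apply: (@grad_length_le v (z + s *: basis_vec i, t')).
    apply: contrapT => nle; apply: nUs; apply: NU; split => //; exact: zcyl.
  apply/ler_normlP; split.
    have := @slope_le_outside_increment R (fun s => - g s) 0 h c C rho U h0 oU muU c0 (ltW C0).
    rewrite subr0 opprK => H; rewrite opprB addrC; apply: H => s sh.
      move=> e' e'0; have [d d0 hd] := lipg s sh; exists d => // u w su us sw ws.
      have /ler_normlP[H _] := hd u w su us sw ws.
      have : 0 <= e' * (w - u) by rewrite mulr_ge0; lra.
      lra.
    have [Us|nUs] := pselect (U s); [by left|right].
    have [dv /ler_normlP[Dv _]] := good s sh nUs.
    by apply: (@derivable_slopeN_le R 'rV[R]_n (fun y => v (y, t'))) => //; lra.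
  have := @slope_le_outside_increment R g 0 h c C rho U h0 oU muU c0 (ltW C0).
  rewrite subr0; apply => s sh.
    move=> e' e'0; have [d d0 hd] := lipg s sh; exists d => // u w su us sw ws.
    have /ler_normlP[_ H] := hd u w su us sw ws.
    have : 0 <= e' * (w - u) by rewrite mulr_ge0; lra.
    lra.
  have [Us|nUs] := pselect (U s); [by left|right].
  have [dv /ler_normlP[_ Dv]] := good s sh nUs.
  by apply: (@derivable_slope_le R 'rV[R]_n (fun y => v (y, t'))).
have close s : 0 <= s <= h -> ball x0 r (x + s *: basis_vec i) ->
    `|v (x + s *: basis_vec i, t) - g s| <= C * rho.
  move=> sh xs; apply: le_trans (vC _ _ _ _) _ => //.
  - by split => /=; [exact: xrOm|rewrite in_itv /= t0].
  - exact: zcyl.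
  rewrite ler_pM2l//; apply: norm_pair_le => /=; last by rewrite ler_norml; lra.
  apply: norm_le_coord => [|j]; first exact: ltW.
  have /andP[z1 z2] := xz j; rewrite !mxE ler_norml; lra.
have := close h _ xhr; rewrite h0 lexx => /(_ isT) /ler_normlP[h1 h2].
have := close 0; rewrite lexx h0 scale0r addr0 => /(_ isT xr) /ler_normlP[h3 h4].
by have /ler_normlP[h5 h6] := g_incr; apply/ler_normlP; split; lra.
Qed.

(** The bound passes from coordinate directions to a small cube, from small
    cubes to a segment, and by density to the closed cylinder. *)
Lemma grad_bound_lipschitz Om T v (c : R) : open Om -> convex_domain Om -> 0 < T ->
  [lipschitz v p | p in closed_cylinder Om T] -> 0 <= c ->
  lebesgue_null (cylinder Om T `&` [set p | ~ (`|grad_length v p| <= c%:E)%E]) ->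
  forall x y t, closure Om x -> closure Om y -> 0 <= t <= T ->
  `|v (x, t) - v (y, t)| <= n%:R * c * `|x - y|.
Proof.
move=> oOm cOm T0 /lipschitz_constant[C C0 vC] c0 vN.
have cylC : cylinder Om T `<=` closed_cylinder Om T.
  move=> p [Op /=]; rewrite in_itv /= => /andP[p0 pT]; split => /=.
    exact: subset_closure.
  by rewrite in_itv /= !ltW.
have vC' p q : cylinder Om T p -> cylinder Om T q -> `|v p - v q| <= C * `|p - q|.
  by move=> /cylC cp /cylC cq; exact: vC.
have nc : 0 <= n%:R * c by rewrite mulr_ge0.
have cube x0 r t : ball x0 r `<=` Om -> 0 < t < T -> forall x y, ball x0 r x -> ball x0 r y ->
    `|v (y, t) - v (x, t)| <= n%:R * c * `|y - x|.
  move=> rOm tT; apply: (coordinatewise_lipschitz (g := fun y => v (y, t))) => // z i h rz rzh.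
  case: (leP 0 h) => h0.
    rewrite (ger0_norm h0).
    exact: (grad_bound_coordinate c0 C0 vC' vN rOm rz rzh h0 tT).
  rewrite (ltr0_norm h0) distrC.
  have := @grad_bound_coordinate Om T v C c x0 (z + h *: basis_vec i) r i (- h) t
    c0 C0 vC' vN rOm rzh.
  by rewrite scaleNr addrK; apply => //; rewrite oppr_ge0 ltW.
have open_case x y t : Om x -> Om y -> 0 < t < T -> v (y, t) - v (x, t) <= n%:R * c * `|y - x|.
  move=> Ox Oy tT.
  pose G s := n%:R * c * `|y - x| * s - v (x + s *: (y - x), t).
  have := @locally_nondecreasing_le R G 0 1 ler01.
  rewrite /G mulr0 scale0r addr0 scale1r subrKC mulr1.
  suff H : forall s, 0 <= s <= 1 -> exists2 r, 0 < r & forall u w, 0 <= u -> w <= 1 ->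
     s - r < u -> u <= s -> s <= w -> w < s + r -> G u <= G w.
    by move=> /(_ H); lra.
  move=> s s01; have Os := convex_domain_segment cOm Ox Oy s01.
  have [r r0 hr] := open_ball oOm Os.
  have xy1 : 0 < `|y - x| + 1 by rewrite ltr_wpDl.
  exists (r / (`|y - x| + 1)); first by rewrite divr_gt0.
  have near_s u : `|u - s| < r / (`|y - x| + 1) ->
      ball (x + s *: (y - x)) r (x + u *: (y - x)).
    rewrite ltr_pdivlMr// => us; rewrite -ball_normE /=.
    rewrite opprD addrACA subrr add0r -scalerBl normrZ distrC.
    by apply: le_lt_trans us; rewrite ler_wpM2l// lerDl.
  move=> u w _ _ su us sw ws; rewrite /G.
  have ru := near_s u ltac:(by rewrite ler0_norm ?subr_le0//; lra).
  have rw := near_s w ltac:(by rewrite ger0_norm ?subr_ge0//; lra).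
  have rOm : ball (x + s *: (y - x)) r `<=` Om.
    by move=> q; rewrite -ball_normE /=; exact: hr.
  have /ler_normlP[_] := cube _ _ _ rOm tT _ _ ru rw.
  rewrite opprD addrACA subrr add0r -scalerBl normrZ ger0_norm; last lra.
  lra.
move=> x y t cx cy t0T.
wlog suff H : x y cx cy / v (y, t) - v (x, t) <= n%:R * c * `|y - x|.
  apply/ler_normlP; split; last exact: H.
  by rewrite opprB distrC; exact: H.
apply/ler_addgt0Pr => e e0.
pose A := 2 * C + 2 * (n%:R * c).
have A0 : 0 < A by rewrite /A; lra.
pose d := Num.min (e / A) (T / 2).
have d0 : 0 < d by rewrite lt_min !divr_gt0.
have dA : d * A <= e by rewrite -ler_pdivlMr// ge_min lexx.
have dT : d <= T / 2 by rewrite ge_min lexx orbT.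
have [x' Ox' xx'] := closure_ball cx d0.
have [y' Oy' yy'] := closure_ball cy d0.
have [t' t'T tt'] : exists2 t', 0 < t' < T & `|t - t'| <= d.
  have /andP[t0 tT] := t0T.
  case: (leP t (T / 2)) => tT2.
    by exists (t + d / 2); rewrite ?ler_norml; apply/andP; split; lra.
  by exists (t - d / 2); rewrite ?ler_norml; apply/andP; split; lra.
have cyl' z z' : closure Om z -> Om z' -> `|z - z'| < d -> `|v (z, t) - v (z', t')| <= C * d.
  move=> cz Oz' zz'; apply: le_trans (vC _ _ _ _) _.
  - by split => //=; rewrite in_itv.
  - by apply: cylC; split => //=; rewrite in_itv.
  by rewrite ler_pM2l//; apply: norm_pair_le => //=; exact: ltW.
have /ler_normlP[h1 h2] := cyl' _ _ cx Ox' xx'.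
have /ler_normlP[h3 h4] := cyl' _ _ cy Oy' yy'.
have h5 := open_case x' y' t' Ox' Oy' t'T.
have h6 : `|y' - x'| <= `|y - x| + 2 * d.
  have -> : y' - x' = (y - x) + ((x - x') - (y - y')).
    by apply/rowP => i; rewrite !mxE; ring.
  apply: le_trans (ler_normD _ _) _; rewrite lerD2l.
  by apply: le_trans (ler_normB _ _) _; lra.
have := ler_wpM2l nc h6; move: dA; rewrite /A.
lra.
Qed.

Lemma Linfty_norm_null (A : set ('rV[R]_n * R)) (g : 'rV[R]_n * R -> \bar R) (K c : R) :
  Linfty_norm A g = K%:E -> K < c ->
  lebesgue_null (A `&` [set p | ~ (`|g p| <= c%:E)%E]).
Proof.
move=> gK Kc; have : (Linfty_norm A g < c%:E)%E by rewrite gK lte_fin.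
move=> /ereal_inf_lt[c' /= c'N c'c] e e0; have [a [b [ab Nab sum]]] := c'N e e0.
exists a, b; split => // p [Ap /= ngc]; apply: Nab; split => //= gc'; apply: ngc.
by apply: le_trans gc' (ltW c'c).
Qed.

Lemma lebesgue_null_sub (A B : set ('rV[R]_n * R)) : A `<=` B ->
  lebesgue_null B -> lebesgue_null A.
Proof.
move=> AB B0 e e0; have [a [b [ab Nab sum]]] := B0 e e0.
by exists a, b; split => // p /AB /Nab.
Qed.

Lemma Linfty_norm_le (A : set ('rV[R]_n * R)) (g : 'rV[R]_n * R -> R) (B : R) :
  (forall p, A p -> `|g p| <= B) -> (Linfty_norm A (fun p => (g p)%:E) <= B%:E)%E.
Proof.
move=> gB; apply: ereal_inf_lbound => /= e e0; exists (fun=> (0, 0)), (fun=> (0, 0)); split.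
- by move=> k; split.
- by move=> p [/gB gp] /=; rewrite lee_fin.
rewrite eseries0 ?lee_fin ?ltW// => k _ _.
by rewrite /box_volume /= subrr mulr0.
Qed.

End gradient_bound.

(** * Contact of a classical solution with a paraboloid *)

Section contact_from_above.
Context {R : realType}.
Implicit Types (g : R -> R) (a b d r : R).

Lemma scaler1 (h : R) : h *: (1 : R) = h.
Proof. exact: mulr1. Qed.

(** Contact is used on one side only, since the time interval of the doubled
    functional has a left end point. *)
Lemma right_contact_slope g a c d r : is_derive (0 : R) (1 : R) g d -> 0 < r ->
  (forall h, 0 <= h < r -> g h <= g 0 + a * h + c * h ^+ 2) -> d <= a.
Proof.
move=> [dg <-] r0 H; apply/ler_addgt0Pr => e e0.
have [r1 r10 h1] := derivable_increment dg (divr_gt0 e0 (ltr0n R 2)).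
have c1 : 0 < 2 * (`|c| + 1) by rewrite mulr_gt0// ltr_wpDl.
pose h := Num.min (Num.min (r / 2) (r1 / 2)) (e / (2 * (`|c| + 1))).
have h0 : 0 < h by rewrite !lt_min !divr_gt0.
have hr : h < r.
  have : h <= r / 2 by rewrite !ge_min lexx.
  lra.
have hr1 : h < r1.
  have : h <= r1 / 2 by rewrite !ge_min lexx ?orbT.
  lra.
have hc : h * `|c| <= e / 2.
  have : h * (2 * (`|c| + 1)) <= e by rewrite -ler_pdivlMr// ge_min lexx orbT.
  lra.
have := H h; rewrite (ltW h0) hr => /(_ isT).
have := h1 h; rewrite gtr0_norm// => /(_ hr1); rewrite add0r scaler1.
move=> /ler_normlP[+ _] H2.
have : c * h ^+ 2 <= e / 2 * h.
  rewrite expr2 mulrA ler_wpM2r ?(ltW h0)//; apply: le_trans hc.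
  by rewrite mulrC ler_wpM2l ?(ltW h0)// ler_norm.
move=> H3 H1; rewrite -(ler_pM2r h0); lra.
Qed.

(** If [b < d], then [g1 h] exceeds [a + b * h] by a multiple of [h], and
    integrating from [0] violates the contact inequality. *)
Lemma contact_second_order g g1 a b d r : 0 < r ->
  (forall s, `|s| < r -> is_derive s (1 : R) g (g1 s)) ->
  is_derive (0 : R) (1 : R) g1 d ->
  (forall h, `|h| < r -> g h <= g 0 + a * h + b / 2 * h ^+ 2) ->
  g1 0 = a /\ d <= b.
Proof.
move=> r0 dg dg1 H.
have g10 : g1 0 = a.
  have d0 : is_derive 0 (1 : R) g (g1 0) by apply: dg; rewrite normr0.
  apply/le_anti/andP; split.
    apply: (right_contact_slope (c := b / 2) d0 r0) => h /andP[h0 hr].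
    by apply: H; rewrite ger0_norm.
  have dN : is_derive 0 (1 : R) (g \o -%R) (- g1 0).
    have dopp : is_derive 0 (1 : R) (-%R : R -> R) (-1).
      exact: is_deriveN.
    have := @is_derive1_comp R g -%R 0 (g1 0) (-1).
    rewrite oppr0 mulrN1 => K; exact: K.
  rewrite -lerN2; apply: (right_contact_slope (c := b / 2) dN r0) => h /andP[h0 hr].
  by rewrite /= oppr0; have := H (- h); rewrite normrN ger0_norm// sqrrN; lra.
split=> //; rewrite leNgt; apply/negP => bd.
pose e := (d - b) / 2; have e0 : 0 < e by rewrite divr_gt0 ?subr_gt0.
have [r1 r10 h1] := derivable_increment (@ex_derive _ _ _ _ _ _ _ dg1) e0.
pose h := Num.min r r1 / 2.
have m0 : 0 < Num.min r r1 by rewrite lt_min r0 r10.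
have h0 : 0 < h by rewrite divr_gt0.
have hr : h < r.
  have : Num.min r r1 <= r by rewrite ge_min lexx.
  rewrite /h; lra.
have hr1 : h < r1.
  have : Num.min r r1 <= r1 by rewrite ge_min lexx orbT.
  rewrite /h; lra.
pose psi s := a * s + (b + e) / 2 * s ^+ 2 - g s.
have dpsi s : 0 <= s <= h -> is_derive s (1 : R) psi (a + (b + e) * s - g1 s).
  move=> /andP[s0 sh]; have ds : is_derive s (1 : R) g (g1 s).
    by apply: dg; rewrite ger0_norm//; lra.
  by apply: is_derive_eq; rewrite !scaler1 -[_ *: (s + s)]/(_ * _); lra.
have := @slope_le_increment R psi 0 h 0 (ltW h0); rewrite mul0r.
suff K : forall s, 0 <= s <= h -> slope_le psi 0 s.
  move=> /(_ K); rewrite /psi mulr0 expr0n mulr0.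
  have := H h; rewrite gtr0_norm// => /(_ hr).
  have : 0 < e / 2 * h ^+ 2 by apply: mulr_gt0; [rewrite divr_gt0|rewrite exprn_gt0].
  lra.
move=> s sh; have [ds Ds] := dpsi s sh; move: sh => /andP[s0 sh].
have sE : s = 0 + s *: 1 :> R by rewrite add0r scaler1.
have -> : psi = (fun t => psi (0 + t *: 1)).
  by apply/funext => t; rewrite add0r scaler1.
rewrite sE in ds Ds.
apply: derivable_slope_le ds _; rewrite Ds -sE.
have := h1 s; rewrite ger0_norm// => /(_ ltac:(lra)).
rewrite -sE g10 derive_val => /ler_normlP[+ _]; rewrite /e; lra.
Qed.

Lemma is_derive_line (V : normedModType R) (f : V -> R) (x v : V) (s : R) :
  derivable f (x + s *: v) v ->
  is_derive s (1 : R) (fun u => f (x + u *: v)) ('D_v f (x + s *: v)).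
Proof.
move=> df.
have E : (fun h : R => h^-1 *: (((fun u => f (x + u *: v)) \o shift s) (h *: 1) - f (x + s *: v)))
   = (fun h => h^-1 *: ((f \o shift (x + s *: v)) (h *: v) - f (x + s *: v))).
  apply/funext => h /=; congr (_ *: (f _ - _)).
  by rewrite scaler1 scalerDl addrCA.
by split; rewrite /derivable /derive E.
Qed.

End contact_from_above.

Section viscous_contact.
Context {R : realType} {n : nat}.

(** The sign [sg] lets the same computation serve contact from above ([sg = 1])
    and contact from below ([sg = -1]). *)
Lemma viscous_solution_contact (Om : set 'rV[R]_n) T nu H f uT eps
    (w : 'rV[R]_n * R -> R) (sg : R) : open Om ->
  0 < eps -> viscous_solution Om T nu H f uT eps w -> sg * sg = 1 ->
  forall x t a b c (p : 'rV[R]_n), Om x -> 0 < t < T ->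
  (forall y, Om y -> sg * w (y, t) <=
     sg * w (x, t) + dot p (y - x) + b / 2 * dot (y - x) (y - x)) ->
  (forall s, t <= s <= T -> sg * w (x, s) <=
     sg * w (x, t) + a * (s - t) + c * (s - t) ^+ 2) ->
  - a - eps * (n%:R * b) + sg * H (sg *: p) <= sg * f (x, t).
Proof.
move=> oOm eps0 [_ [C1 C2] eqn _ _] sg1 x t a b c p Ox tT Hx Ht.
have cyl y : Om y -> cylinder Om T (y, t) by move=> Oy; split => //=; rewrite in_itv.
have [r r0 hr] := open_ball oOm Ox.
have near_x i s : `|s| < r -> Om (x + s *: basis_vec i).
  move=> sr; apply: hr; rewrite opprD addrA subrr add0r normrN normrZ.
  by apply: le_lt_trans sr; rewrite -[leRHS]mulr1 ler_wpM2l// norm_basis_le.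
have dx12 i : sg * dx i w (x, t) = p 0 i /\ sg * dx i (dx i w) (x, t) <= b.
  pose g s := sg * w (x + s *: basis_vec i, t).
  pose g1 s := sg * dx i w (x + s *: basis_vec i, t).
  have dg s : `|s| < r -> is_derive s (1 : R) g (g1 s).
    move=> /(near_x i) Os; have [_ _ /(_ i)[di _]] := C1 _ (cyl _ Os).
    have := is_derive_line di => D; exact: is_deriveZ.
  have dg1 : is_derive (0 : R) (1 : R) g1 (sg * dx i (dx i w) (x, t)).
    have [di _] := C2 _ (cyl _ Ox) i i.
    have di' : derivable (fun y => dx i w (y, t)) (x + 0 *: basis_vec i) (basis_vec i).
      by rewrite scale0r addr0.
    have := is_derive_line di'; rewrite scale0r addr0 => D; exact: is_deriveZ.
  have [|g10 d2] := contact_second_order (a := p 0 i) (b := b) r0 dg dg1.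
    move=> h /(near_x i) Oh; have := Hx _ Oh.
    have -> : x + h *: basis_vec i - x = h *: basis_vec i by rewrite addrC addKr.
    rewrite /g scale0r addr0 !dotZr dotZl !dot_basis mxE !eqxx /=; lra.
  by split => //; rewrite -g10 /g1 scale0r addr0.
have dt1 : sg * dt w (x, t) <= a.
  have [_ [dtw _] _] := C1 _ (cyl _ Ox).
  have dtw' : derivable (fun s => w (x, s)) (t + 0 *: 1) 1.
    by rewrite scale0r addr0.
  have := is_derive_line dtw'; rewrite scale0r addr0 => D.
  have D' : is_derive (0 : R) (1 : R) (fun u => sg * w (x, t + u *: 1)) (sg * dt w (x, t)).
    exact: is_deriveZ.
  have /andP[t0 tltT] := tT.
  apply: (right_contact_slope (r := T - t) (c := c) D'); first by rewrite subr_gt0.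
  move=> h /andP[h0 hT]; have := Ht (t + h); rewrite !scaler1 !addr0.
  have -> : t + h - t = h by rewrite addrC addKr.
  by apply; apply/andP; split; lra.
have Dxw : Dx w (x, t) = sg *: p.
  apply/rowP => i; rewrite /Dx /grad !mxE; have [<- _] := dx12 i.
  by rewrite mulrA sg1 mul1r.
have := eqn _ (cyl _ Ox); rewrite Dxw => <-.
have lap : sg * laplacian w (x, t) <= n%:R * b.
  rewrite /laplacian mulr_sumr -[n in n%:R]card_ord -sum1_card natr_sum mulr_suml.
  by apply: ler_sum => i _; rewrite mul1r; have [] := dx12 i.
have := ler_wpM2l (ltW eps0) lap; lra.
Qed.

(** The inward difference quotient of [w] tends to zero by the Neumann
    condition, and the contact inequality bounds it below by [k - b * h]. *)
Lemma neumann_contact (Om : set 'rV[R]_n) T nu (w : 'rV[R]_n * R -> R) (sg : R) x t d b k :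
  neumann_condition Om T nu w -> frontier Om x -> 0 < t < T -> 0 < d ->
  (forall h, 0 < h < d -> sg * w (x - h *: nu x, t) <= sg * w (x, t) - k * h + b * h ^+ 2) ->
  k <= 0.
Proof.
move=> Nw fx tT d0 Hh.
have lim0 : - `|b| * h + k @[h --> (0 : R)^'+] --> k.
  have : - `|b| * h + k @[h --> (0 : R)^'+] --> - `|b| * 0 + k; last first.
    by rewrite mulr0 add0r.
  apply: cvgD; last exact: cvg_cst.
  apply: cvgM; first exact: cvg_cst.
  exact: cvg_within.
have lim1 : sg * (h^-1 * (w (x, t) - w (x - h *: nu x, t))) @[h --> (0 : R)^'+] --> (0 : R).
  have : sg * (h^-1 * (w (x, t) - w (x - h *: nu x, t))) @[h --> (0 : R)^'+] --> sg * 0.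
    by apply: cvgM; [exact: cvg_cst|exact: Nw].
  by rewrite mulr0.
apply: (ler_cvg_to lim0 lim1).
have : \forall h \near (0 : R)^'+, 0 < h < d.
  near=> h; apply/andP; split; first by near: h; exact: nbhs_right_gt.
  by near: h; exact: nbhs_right_lt.
apply: filterS => h /andP[h0 hd]; have := Hh h; rewrite h0 hd => /(_ isT) H.
rewrite mulrCA -(ler_pM2l h0) mulVKf ?gt_eqF//.
have : b * h ^+ 2 <= `|b| * h ^+ 2 by rewrite ler_wpM2r ?ler_norm// sqr_ge0.
lra.
Unshelve. all: by end_near.
Qed.

End viscous_contact.

(** * Quadratic test functions for viscosity solutions *)

Section quadratic_test_functions.
Context {R : realType} {n : nat}.

Lemma is_derive_quadratic (V : normedModType R) (g : V -> R) x v A B :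
  (forall h, g (x + h *: v) = g x + h * A + h ^+ 2 * B) -> is_derive x v g A.
Proof.
move=> gE.
have E : (fun h : R => h^-1 *: ((g \o shift x) (h *: v) - g x)) @ 0^' --> A.
  have L : A + h * B @[h --> (0 : R)^'] --> A.
    have : A + h * B @[h --> (0 : R)^'] --> A + 0 * B; last by rewrite mul0r addr0.
    apply: cvgD; first exact: cvg_cst.
    by apply: cvgM; [exact: cvg_within|exact: cvg_cst].
  apply: cvg_trans L; apply: near_eq_cvg; near=> h.
  have h0 : h != 0 by near: h; exact: nbhs_dnbhs_neq.
  by rewrite /= [h *: v + x]addrC gE -[_ *: (_ - _)]/(_ * _); field.
by split; [apply/cvg_ex; exists A|exact: cvg_lim E].
Unshelve. all: by end_near. Qed.

Definition quadratic_test (y0 : 'rV[R]_n) (s0 : R) (q : 'rV[R]_n) (b a c : R)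
    (p : 'rV[R]_n * R) : R :=
  dot q (p.1 - y0) + b / 2 * dot (p.1 - y0) (p.1 - y0) +
  (a * (p.2 - s0) + c * (p.2 - s0) ^+ 2).

Variables (y0 : 'rV[R]_n) (s0 : R) (q : 'rV[R]_n) (b a c : R).
Let phi := quadratic_test y0 s0 q b a c.

Let is_dt p : is_derive p.2 (1 : R) (fun s => phi (p.1, s)) (a + 2 * c * (p.2 - s0)).
Proof.
apply: (@is_derive_quadratic R _ _ _ _ c) => h.
by rewrite /phi /quadratic_test /= scaler1; ring.
Qed.

Let is_dx p i : is_derive p.1 (basis_vec i) (fun y => phi (y, p.2)) 
  (q 0 i + b * (p.1 - y0) 0 i).
Proof.
apply: (@is_derive_quadratic _ _ _ _ _ (b / 2)) => h.
rewrite /phi /quadratic_test /=.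
have -> : p.1 + h *: basis_vec i - y0 = (p.1 - y0) + h *: basis_vec i by rewrite addrAC.
move: (p.1 - y0) => z.
rewrite !dotDr !dotDl !dotZr !dotZl !(dotC (basis_vec i)) !dot_basis mxE !eqxx /=.
by field.
Qed.

Lemma dt_quadratic_test p : dt phi p = a + 2 * c * (p.2 - s0).
Proof. exact: derive_val. Qed.

Lemma dx_quadratic_test p i : dx i phi p = q 0 i + b * (p.1 - y0) 0 i.
Proof. exact: derive_val. Qed.

Let continuous_coord i : continuous (fun p : 'rV[R]_n * R => (p.1 - y0) 0 i).
Proof.
move=> p; under eq_fun do rewrite !mxE.
apply: cvgB; last exact: cvg_cst.
apply: (@continuous_comp _ _ _ fst (fun z : 'rV[R]_n => z 0 i) p).
  exact: cvg_fst.
exact: coord_continuous.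
Qed.

Let continuous_time : continuous (fun p : 'rV[R]_n * R => p.2 - s0).
Proof. by move=> p; apply: cvgB; [exact: cvg_snd|exact: cvg_cst]. Qed.

Lemma continuous_quadratic_test : continuous phi.
Proof.
move=> p; apply: cvgD.
  apply: cvgD.
    apply: continuous_big => [|i _ z]; first exact: add_continuous.
    by apply: (@cvgM _ _ (nbhs z)); [exact: cvg_cst|exact: continuous_coord].
  apply: cvgM; first exact: cvg_cst.
  apply: continuous_big => [|i _ z]; first exact: add_continuous.
  by apply: (@cvgM _ _ (nbhs z)); exact: continuous_coord.
apply: cvgD.
  by apply: cvgM; [exact: cvg_cst|exact: continuous_time].
apply: cvgM; first exact: cvg_cst.
by apply: cvgM; exact: continuous_time.
Qed.

Lemma C1_quadratic_test (A : set ('rV[R]_n * R)) : C1_on A phi.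
Proof.
move=> p _; split; first exact: continuous_quadratic_test.
  split; first exact: ex_derive.
  rewrite (_ : dt phi = fun p => a + 2 * c * (p.2 - s0)); last first.
    by apply/funext => z; exact: dt_quadratic_test.
  apply: cvgD; first exact: cvg_cst.
  by apply: cvgM; [exact: cvg_cst|exact: continuous_time].
move=> i; split; first exact: ex_derive.
rewrite (_ : dx i phi = fun p => q 0 i + b * (p.1 - y0) 0 i); last first.
  by apply/funext => z; exact: dx_quadratic_test.
apply: cvgD; first exact: cvg_cst.
by apply: cvgM; [exact: cvg_cst|exact: continuous_coord].
Qed.

Lemma quadratic_test_at : [/\ phi (y0, s0) = 0, dt phi (y0, s0) = a & Dx phi (y0, s0) = q].
Proof.
split.
- by rewrite /phi /quadratic_test /= !subrr /dot !big1 ?mulr0 ?addr0//= => [|i _|i _];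
    rewrite ?mxE ?expr0n ?mulr0 ?addr0.
- by rewrite dt_quadratic_test /= subrr mulr0 addr0.
- by apply/rowP => i; rewrite mxE -[LHS]/(dx i phi (y0, s0)) dx_quadratic_test /=
    subrr mxE mulr0 addr0.
Qed.

End quadratic_test_functions.

Section viscosity_contact.
Context {R : realType} {n : nat}.

Lemma quadratic_testZ (y0 : 'rV[R]_n) s0 q b a c k p :
  quadratic_test y0 s0 (k *: q) (k * b) (k * a) (k * c) p = k * quadratic_test y0 s0 q b a c p.
Proof. by rewrite /quadratic_test dotZl; ring. Qed.

(** The sign condition on [q] discards the boundary alternative of the
    viscosity inequality. For [sg = -1] the test function is the opposite one and
    the subsolution property is used. *)
Lemma viscosity_solution_contact (Om : set 'rV[R]_n) T nu H f uT
    (u : 'rV[R]_n * R -> R) (sg : R) : open Om ->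
  viscosity_solution Om T nu H f uT u -> sg = 1 \/ sg = -1 ->
  forall y0 s0 a b c (q : 'rV[R]_n), closure Om y0 -> 0 < s0 < T ->
  (forall y s, closure Om y -> 0 < s < T ->
     sg * u (y0, s0) + quadratic_test y0 s0 q b a c (y, s) <= sg * u (y, s)) ->
  (frontier Om y0 -> dot q (nu y0) < 0) ->
  0 <= - a + sg * H (sg *: q) - sg * f (y0, s0).
Proof.
move=> oOm [_ sub super _] sg1 y0 s0 a b c q cy0 s0T touch qnu.
have cyl : cylinder (closure Om) T (y0, s0) by split => //=; rewrite in_itv.
case: sg1 => sgE; rewrite sgE in touch *.
  have [phi0 phit phix] := quadratic_test_at y0 s0 q b a c.
  have [|hin hfr] := super (quadratic_test y0 s0 q b a c) (y0, s0)
      (@C1_quadratic_test _ _ _ _ _ _ _ _ _).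
    split => //; near=> p => -[/= p1 p2]; rewrite phi0.
    have := touch p.1 p.2 p1; rewrite !mul1r -surjective_pairing.
    move: p2; rewrite in_itv /= => p2 /(_ p2); lra.
  rewrite scale1r !mul1r; have [Oy|fy] := closure_frontierP oOm cy0.
    by have := hin Oy; rewrite /residual phit phix.
  have := hfr fy; rewrite /residual /normal_derivative phit phix /= => h.
  by move: h; rewrite le_max [0 <= dot _ _]leNgt qnu// orbF.
have [phi0 phit phix] := quadratic_test_at y0 s0 (-1 *: q) (-1 * b) (-1 * a) (-1 * c).
have [|hin hfr] := sub (quadratic_test y0 s0 (-1 *: q) (-1 * b) (-1 * a) (-1 * c))
    (y0, s0) (@C1_quadratic_test _ _ _ _ _ _ _ _ _).
  split => //; near=> p => -[/= p1 p2]; rewrite phi0 quadratic_testZ.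
  have := touch p.1 p.2 p1; rewrite -surjective_pairing.
  move: p2; rewrite in_itv /= => p2 /(_ p2); lra.
have [Oy|fy] := closure_frontierP oOm cy0.
  by have := hin Oy; rewrite /residual phit phix /=; lra.
have := hfr fy; rewrite /residual /normal_derivative phit phix /= => h.
have qnu' : 0 < dot (-1 *: q) (nu y0) by rewrite dotZl mulN1r oppr_gt0 qnu.
move: h; rewrite ge_min [dot _ _ <= 0]leNgt qnu' orbF; lra.
Unshelve. all: by end_near. Qed.

End viscosity_contact.

(** * The doubled functional and its maximum *)

Section doubling.
Context {R : realType} {n : nat}.
Implicit Types (x y z : 'rV[R]_n) (t s : R).

Lemma small_multiplier (A e : R) : 0 <= A -> 0 < e ->
  exists k, [/\ 0 < k, k <= 1 & k * A <= e].
Proof.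
move=> A0 e0; have A1 : 0 < A + 1 by rewrite ltr_wpDl.
exists (Num.min 1 (e / (A + 1))); split.
- by rewrite lt_min ltr01 divr_gt0.
- by rewrite ge_min lexx.
have : Num.min 1 (e / (A + 1)) * (A + 1) <= e by rewrite -ler_pdivlMr// ge_min lexx orbT.
have : 0 <= Num.min 1 (e / (A + 1)) by rewrite le_min ler01 divr_ge0// ltW.
lra.
Qed.

Lemma lipschitz_within_continuous (V : normedModType R) (A : set V) (g : V -> R) (C : R) :
  (forall p q, A p -> A q -> `|g p - g q| <= C * `|p - q|) ->
  {within A, continuous g}.
Proof.
move=> gC; apply/subspace_continuousP => p Ap; apply/cvgrPdist_le => e e0.
have C1 : 0 < `|C| + 1 by rewrite ltr_wpDl.
near=> q.
have Aq : A q by near: q; exact: withinT.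
apply: le_trans (gC p q Ap Aq) _.
have pq : `|p - q| <= e / (`|C| + 1).
  near: q; apply: cvg_within; apply/nbhs_ballP; exists (e / (`|C| + 1)).
    by rewrite /= divr_gt0.
  by move=> q; rewrite -ball_normE /= => /ltW.
move: pq; rewrite ler_pdivlMr// => pq; apply: le_trans pq.
rewrite mulrC ler_wpM2l//; apply: le_trans (ler_norm C) _; lra.
Unshelve. all: by end_near. Qed.

Lemma norm_components_le (V W : normedModType R) (P : V * W) :
  `|P.1| <= `|P| /\ `|P.2| <= `|P|.
Proof. by rewrite prod_normE !le_max !lexx orbT. Qed.

Lemma compact_closure_ball (Om : set 'rV[R]_n) x0 (r : R) : 0 < r ->
  compact (closure Om `&` [set x | `|x0 - x| <= r]).
Proof.
move=> r0; apply: bounded_closed_compact.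
  exists (`|x0| + r); split; first exact: num_real.
  move=> M hM x [_ /= xr]; apply: le_trans (ltW hM).
  have -> : x = x0 - (x0 - x) by rewrite opprB addrCA subrr addr0.
  by apply: le_trans (ler_normB _ _) _; rewrite lerD2l.
apply: closedI; first exact: closed_closure.
rewrite -[X in closed X](closed_ballE x0 r0)//; exact: closed_ball_closed.
Qed.

Lemma continuous_dot_diag : continuous (fun z : 'rV[R]_n => dot z z).
Proof.
apply: continuous_big => [|i _ z]; first exact: add_continuous.
by apply: (@cvgM _ _ (nbhs z)); exact: coord_continuous.
Qed.

Variables (Om : set 'rV[R]_n) (T : R) (w v : 'rV[R]_n * R -> R) (C : R).
Hypotheses (T0 : 0 < T) (C0 : 0 < C).
Hypothesis lipw : forall p q, closed_cylinder Om T p -> closed_cylinder Om T q ->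
  `|w p - w q| <= C * `|p - q|.
Hypothesis lipv : forall p q, closed_cylinder Om T p -> closed_cylinder Om T q ->
  `|v p - v q| <= C * `|p - q|.
Hypothesis wvT : forall x, closure Om x -> w (x, T) = v (x, T).

Definition penalty x0 (lam d tau eta : R) (P : ('rV[R]_n * R) * ('rV[R]_n * R)) : R :=
  lam * (T - P.1.2) + dot (P.1.1 - P.2.1) (P.1.1 - P.2.1) / (2 * d) +
  (P.1.2 - P.2.2) ^+ 2 / (2 * tau) +
  eta / 2 * (dot (P.1.1 - x0) (P.1.1 - x0) + dot (P.2.1 - x0) (P.2.1 - x0)).

Lemma continuous_penalty x0 lam d tau eta : continuous (penalty x0 lam d tau eta).
Proof.
have cdot (h : ('rV[R]_n * R) * ('rV[R]_n * R) -> 'rV[R]_n) :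
    continuous h -> continuous (fun P => dot (h P) (h P)).
  move=> ch P; apply: (@continuous_comp _ _ _ h (fun z => dot z z) P); first exact: ch.
  exact: continuous_dot_diag.
have c11 : continuous (fun P : ('rV[R]_n * R) * ('rV[R]_n * R) => P.1.1).
  by move=> P; apply: (@continuous_comp _ _ _ fst fst P); exact: cvg_fst.
have c12 : continuous (fun P : ('rV[R]_n * R) * ('rV[R]_n * R) => P.1.2).
  by move=> P; apply: (@continuous_comp _ _ _ fst snd P); [exact: cvg_fst|exact: cvg_snd].
have c21 : continuous (fun P : ('rV[R]_n * R) * ('rV[R]_n * R) => P.2.1).
  by move=> P; apply: (@continuous_comp _ _ _ snd fst P); [exact: cvg_snd|exact: cvg_fst].
have c22 : continuous (fun P : ('rV[R]_n * R) * ('rV[R]_n * R) => P.2.2).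
  by move=> P; apply: (@continuous_comp _ _ _ snd snd P); exact: cvg_snd.
move=> P; apply: cvgD; first apply: cvgD; first apply: cvgD.
- apply: cvgM; first exact: cvg_cst.
  by apply: cvgB; [exact: cvg_cst|exact: c12].
- apply: cvgM; last exact: cvg_cst.
  by apply: cdot => Q; apply: cvgB; [exact: c11|exact: c21].
- apply: cvgM; last exact: cvg_cst.
  by apply: cvgM; apply: cvgB; [exact: c12|exact: c22|exact: c12|exact: c22].
apply: cvgM; first exact: cvg_cst.
apply: cvgD; apply: cdot => Q; apply: cvgB; try exact: cvg_cst; [exact: c11|exact: c21].
Qed.

(** Both functions are Lipschitz in time and agree at time [T], so their
    difference stays bounded even on an unbounded domain. *)
Lemma difference_le_terminal x y t s : closure Om x -> closure Om y -> 0 <= t <= T -> 0 <= s <= T ->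
  forall K, (forall z z' r, closure Om z -> closure Om z' -> 0 <= r <= T ->
    `|v (z, r) - v (z', r)| <= K * `|z - z'|) ->
  w (x, t) - v (y, s) <= K * `|x - y| + C * ((T - t) + (T - s)).
Proof.
move=> cx cy tT sT K vK.
have T1 : 0 <= T <= T by rewrite lexx ltW.
have cyl z r : closure Om z -> 0 <= r <= T -> closed_cylinder Om T (z, r).
  by move=> cz rT; split => //=; rewrite in_itv.
have gap z r r' c : r <= r' -> r' - r = c -> `|((z, r) : 'rV[R]_n * R) - (z, r')| <= c.
  move=> rr' <-; apply: norm_pair_le => /=; first by rewrite subrr normr0; lra.
  by rewrite ler0_norm ?subr_le0// opprB.
have /andP[t0 t1] := tT; have /andP[s0 s1] := sT.
have /ler_normlP[_ h1] := le_trans (lipw (cyl x t cx tT) (cyl x T cx T1))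
  (ler_wpM2l (ltW C0) (gap x t T _ t1 erefl)).
have /ler_normlP[h2 _] := le_trans (lipv (cyl y s cy sT) (cyl y T cy T1))
  (ler_wpM2l (ltW C0) (gap y s T _ s1 erefl)).
have /ler_normlP[_ h3] := vK x y T cx cy T1.
move: h1; rewrite (wvT cx); lra.
Qed.

(** The quadratic penalty at infinity makes the maximum of the doubled function
    attained although [Om] may be unbounded. *)
Lemma doubled_maximum x0 t0 lam d tau eta : Om x0 -> 0 < t0 < T -> 0 <= lam ->
  0 < d -> 0 < tau -> 0 < eta ->
  0 < w (x0, t0) - v (x0, t0) - lam * (T - t0) ->
  exists x t y s, [/\ closure Om x, closure Om y, t0 <= t <= T, 0 <= s <= T &
   forall x' t' y' s', closure Om x' -> closure Om y' -> t0 <= t' <= T -> 0 <= s' <= T ->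
    w (x', t') - v (y', s') - penalty x0 lam d tau eta ((x', t'), (y', s')) <=
    w (x, t) - v (y, s) - penalty x0 lam d tau eta ((x, t), (y, s))].
Proof.
move=> Ox0 /andP[t00 t0T] lam0 d0 tau0 eta0 pos.
pose F P := w P.1 - v P.2 - penalty x0 lam d tau eta P.
have cx0 : closure Om x0 by exact: subset_closure.
have T1 : 0 <= T <= T by rewrite lexx ltW.
have F0 : 0 < F ((x0, t0), (x0, t0)).
  have dot00 : dot (0 : 'rV[R]_n) 0 = 0 by rewrite /dot big1// => i _; rewrite mxE mulr0.
  by rewrite /F /penalty /= !subrr dot00 expr0n/= !mul0r !addr0 mulr0 addr0.
have [r r0 hr] : exists2 r, 0 < r & forall x t y s, closure Om x -> closure Om y ->
    t0 <= t <= T -> 0 <= s <= T -> 0 < F ((x, t), (y, s)) ->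
    `|x0 - x| <= r /\ `|x0 - y| <= r.
  pose B := C ^+ 2 * d / 2 + 2 * C * T.
  have B0 : 0 <= B by rewrite /B addr_ge0// ?divr_ge0// !mulr_ge0// ltW.
  have [k [k0 _ hk]] := small_multiplier B0 (divr_gt0 eta0 (ltr0n R 2)).
  exists (Num.sqrt (1 / k)); first by rewrite sqrtr_gt0 divr_gt0.
  move=> x t y s cx cy /andP[t1 t2] /andP[s1 s2] Fp.
  have tT : 0 <= t <= T by apply/andP; split; lra.
  have sT : 0 <= s <= T by apply/andP; split.
  have vC z z' q : closure Om z -> closure Om z' -> 0 <= q <= T ->
      `|v (z, q) - v (z', q)| <= C * `|z - z'|.
    move=> cz cz' qT; apply: le_trans (lipv _ _) _.
    - by split => //=; rewrite in_itv.
    - by split => //=; rewrite in_itv.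
    by rewrite ler_pM2l//; apply: norm_pair_le => //=; rewrite subrr normr0.
  have gap := difference_le_terminal cx cy tT sT vC.
  have D1 := sqr_norm_le_dot (x - y).
  have X1 := sqr_norm_le_dot (x - x0); have Y1 := sqr_norm_le_dot (y - x0).
  have key : eta / 2 * (`|x - x0| ^+ 2 + `|y - x0| ^+ 2) <= B.
    have h1 : eta / 2 * (`|x - x0| ^+ 2 + `|y - x0| ^+ 2) <=
       eta / 2 * (dot (x - x0) (x - x0) + dot (y - x0) (y - x0)).
      by rewrite ler_pM2l ?divr_gt0//; lra.
    have h2 : `|x - y| ^+ 2 / (2 * d) <= dot (x - y) (x - y) / (2 * d).
      by rewrite ler_pM2r// invr_gt0 mulr_gt0.
    have h3 : 0 <= (t - s) ^+ 2 / (2 * tau).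
      by rewrite divr_ge0 ?sqr_ge0// mulr_ge0// ltW.
    have h4 : 0 <= lam * (T - t) by rewrite mulr_ge0// subr_ge0.
    have h5 : C * `|x - y| <= C ^+ 2 * d / 2 + `|x - y| ^+ 2 / (2 * d).
      rewrite -subr_ge0.
      have -> : C ^+ 2 * d / 2 + `|x - y| ^+ 2 / (2 * d) - C * `|x - y| =
          (C * d - `|x - y|) ^+ 2 / (2 * d) by field; rewrite gt_eqF.
      by rewrite divr_ge0 ?sqr_ge0// mulr_ge0// ltW.
    have h6 : C * (T - t + (T - s)) <= 2 * C * T.
      by rewrite [2 * C]mulrC -mulrA ler_pM2l//; lra.
    move: Fp; rewrite /F /penalty /=; rewrite /B; lra.
  have sq z : eta / 2 * `|z - x0| ^+ 2 <= B -> `|x0 - z| <= Num.sqrt (1 / k).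
    move=> zB; rewrite distrC -[leLHS]ger0_norm// -sqrtr_sqr ler_sqrt; last first.
      by rewrite divr_ge0// ltW.
    rewrite ler_pdivlMr//.
    have : k * (eta / 2 * `|z - x0| ^+ 2) <= eta / 2.
      by apply: le_trans hk; rewrite ler_pM2l.
    rewrite mulrCA => h; rewrite -(@ler_pM2l _ (eta / 2)) ?divr_gt0// mulr1.
    by rewrite [_ ^+ 2 * k]mulrC.
  have e20 : 0 <= eta / 2 by rewrite divr_ge0// ltW.
  by split; apply: sq; apply: le_trans key; rewrite ler_wpM2l// ?lerDl ?lerDr ?sqr_ge0.
pose A := ((closure Om `&` [set x | `|x0 - x| <= r]) `*` `[t0, T]) `*`
          ((closure Om `&` [set x | `|x0 - x| <= r]) `*` `[0, T]).
have cA : compact A.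
  by apply: compact_setX; apply: compact_setX;
    [exact: compact_closure_ball|exact: segment_compact|
     exact: compact_closure_ball|exact: segment_compact].
have Ax0 : A ((x0, t0), (x0, t0)).
  have Bx0 : (closure Om `&` [set x | `|x0 - x| <= r]) x0.
    by split => //=; rewrite subrr normr0 ltW.
  by split; split => //=; rewrite in_itv /= ?lexx !ltW.
have sub1 P : A P -> closed_cylinder Om T P.1 /\ closed_cylinder Om T P.2.
  move=> [[[h1 _] h2] [[h3 _] h4]]; split; split; [exact: h1| |exact: h3|exact: h4].
  move: h2; rewrite /= !in_itv /= => /andP[h5 ->].
  by rewrite (le_trans (ltW t00) h5).
have contF : {within A, continuous F}.
  have c1 : {within A, continuous (fun P : ('rV[R]_n * R) * ('rV[R]_n * R) => w P.1 - v P.2)}.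
    apply: (@lipschitz_within_continuous _ _ _ (2 * C)) => P Q AP AQ.
    have [P1 P2] := sub1 P AP; have [Q1 Q2] := sub1 Q AQ.
    have -> : w P.1 - v P.2 - (w Q.1 - v Q.2) = (w P.1 - w Q.1) - (v P.2 - v Q.2) by ring.
    apply: le_trans (ler_normB _ _) _.
    have -> : 2 * C * `|P - Q| = C * `|P - Q| + C * `|P - Q| by ring.
    have [PQ1 PQ2] := norm_components_le (P - Q).
    exact: lerD (le_trans (lipw P1 Q1) (ler_wpM2l (ltW C0) PQ1))
      (le_trans (lipv P2 Q2) (ler_wpM2l (ltW C0) PQ2)).
  move=> P; apply: cvgB; first exact: c1.
  by apply: continuous_subspaceT; exact: continuous_penalty.
have [M /set_mem AM maxM] := compact_EVT_max (ex_intro _ _ Ax0) cA contF.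
have FM : F ((x0, t0), (x0, t0)) <= F M by apply: maxM; rewrite inE.
case: M AM maxM FM => [[x t] [y s]] [[[cx _] /= tt] [[cy _] /= ss]] maxM FM.
exists x, t, y, s; move: tt ss; rewrite !in_itv /= => tt ss; split => //.
move=> x' t' y' s' cx' cy' tt' ss'.
have [FP|FP] := leP (F ((x', t'), (y', s'))) 0.
  by apply: le_trans FP (le_trans (ltW F0) FM).
have [rx ry] := hr x' t' y' s' cx' cy' tt' ss' FP.
apply: (maxM ((x', t'), (y', s'))); rewrite inE; split; split => //=; by rewrite in_itv.
Qed.

End doubling.

(** * The one-sided estimate *)

(** What the doubling argument uses of a viscous solution [w] and a first-order
    solution [v]; the contact conditions are the equations, tested with
    quadratics only. *)
Record comparison_pair {R : realType} {n : nat} (Om : set 'rV[R]_n) (T eps : R)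
    (nu : 'rV[R]_n -> 'rV[R]_n) (w v f : 'rV[R]_n * R -> R) (H : 'rV[R]_n -> R)
    (C K L : R) : Prop := ComparisonPair {
  cp_open : open Om;
  cp_convex : convex_domain Om;
  cp_horizon : 0 < T;
  cp_viscosity : 0 < eps;
  cp_normal : forall x, frontier Om x -> outward_unit_normal Om x (nu x);
  cp_constants : [/\ 0 < C, 0 <= K & 0 <= L];
  cp_lipw : forall p q, closed_cylinder Om T p -> closed_cylinder Om T q ->
    `|w p - w q| <= C * `|p - q|;
  cp_lipv : forall p q, closed_cylinder Om T p -> closed_cylinder Om T q ->
    `|v p - v q| <= C * `|p - q|;
  cp_lipf : forall p q, closed_cylinder Om T p -> closed_cylinder Om T q ->
    `|f p - f q| <= C * `|p - q|;
  cp_lipvx : forall x y t, closure Om x -> closure Om y -> 0 <= t <= T ->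
    `|v (x, t) - v (y, t)| <= K * `|x - y|;
  cp_lipfx : forall x y t, closure Om x -> closure Om y -> 0 <= t <= T ->
    `|f (x, t) - f (y, t)| <= L * `|x - y|;
  cp_lipH : forall r, 0 < r -> exists2 CH, 0 < CH &
    forall p q, `|p| < r -> `|q| < r -> `|H p - H q| <= CH * `|p - q|;
  cp_terminal : forall x, closure Om x -> w (x, T) = v (x, T);
  cp_contact_w : forall x t a b c (p : 'rV[R]_n), Om x -> 0 < t < T ->
    (forall y, Om y -> w (y, t) <=
       w (x, t) + dot p (y - x) + b / 2 * dot (y - x) (y - x)) ->
    (forall s, t <= s <= T -> w (x, s) <=
       w (x, t) + a * (s - t) + c * (s - t) ^+ 2) ->
    - a - eps * (n%:R * b) + H p <= f (x, t);
  cp_neumann_w : forall x t d b k, frontier Om x -> 0 < t < T -> 0 < d ->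
    (forall h, 0 < h < d -> w (x - h *: nu x, t) <= w (x, t) - k * h + b * h ^+ 2) ->
    k <= 0;
  cp_contact_v : forall y0 s0 a b c (q : 'rV[R]_n), closure Om y0 -> 0 < s0 < T ->
    (forall y s, closure Om y -> 0 < s < T ->
       v (y0, s0) + quadratic_test y0 s0 q b a c (y, s) <= v (y, s)) ->
    (frontier Om y0 -> dot q (nu y0) < 0) ->
    0 <= - a + H q - f (y0, s0)
}.

(** The times [t] of [w] start at [t0] and those of [v] at [0]: once [t] and [s]
    are close, [s] is positive, while at [t = t0] the one-sided contact of [w] is
    what the equation needs. *)
Record penalized_maximum {R : realType} {n : nat} (Om : set 'rV[R]_n) (T : R)
    (w v : 'rV[R]_n * R -> R) (x0 x y : 'rV[R]_n) (t0 t s lam d tau eta : R) : Prop :=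
  PenalizedMaximum {
  pm_lam : 0 <= lam;
  pm_d : 0 < d;
  pm_tau : 0 < tau;
  pm_eta : 0 < eta;
  pm_center : Om x0;
  pm_start : 0 < t0 < T;
  pm_x : closure Om x;
  pm_y : closure Om y;
  pm_t : t0 <= t <= T;
  pm_s : 0 <= s <= T;
  pm_maximal : forall x' t' y' s', closure Om x' -> closure Om y' ->
    t0 <= t' <= T -> 0 <= s' <= T ->
    w (x', t') - v (y', s') - penalty T x0 lam d tau eta ((x', t'), (y', s')) <=
    w (x, t) - v (y, s) - penalty T x0 lam d tau eta ((x, t), (y, s))
}.

Lemma young_le {R : realType} (c r d : R) : 0 < d -> c * r <= c ^+ 2 * d / 2 + r ^+ 2 / (2 * d).
Proof.
move=> d0; rewrite -subr_ge0.
have -> : c ^+ 2 * d / 2 + r ^+ 2 / (2 * d) - c * r = (c * d - r) ^+ 2 / (2 * d).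
  by field; rewrite gt_eqF.
by rewrite divr_ge0 ?sqr_ge0// mulr_ge0// ltW.
Qed.

Lemma maximum_time_range {R n Om T w v} {x0 x y t0 t s lam d tau eta}
    (M : @penalized_maximum R n Om T w v x0 x y t0 t s lam d tau eta) :
  0 <= t <= T.
Proof.
have [lam0 d0 tau0 eta0 Ox0 t0T cx cy tt ss _] := M.
by move: tt t0T => /andP[t1 ->] /andP[t00 _]; rewrite andbT (le_trans _ t1)// ltW.
Qed.

Lemma penalty_terms_ge0 {R n Om T w v} {x0 x y t0 t s lam d tau eta}
    (M : @penalized_maximum R n Om T w v x0 x y t0 t s lam d tau eta) :
  [/\ 0 <= lam * (T - t), `|x - y| ^+ 2 / (2 * d) <= dot (x - y) (x - y) / (2 * d),
  0 <= (t - s) ^+ 2 / (2 * tau) & 0 <= eta / 2 * (dot (x - x0) (x - x0) + dot (y - x0) (y - x0))].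
Proof.
have [lam0 d0 tau0 eta0 Ox0 t0T cx cy tt ss _] := M.
split.
- by move: tt => /andP[_ tT]; rewrite mulr_ge0// subr_ge0.
- by rewrite ler_pM2r ?invr_gt0 ?mulr_gt0// sqr_norm_le_dot.
- by rewrite divr_ge0 ?sqr_ge0// mulr_ge0// ltW.
- by rewrite mulr_ge0 ?addr_ge0 ?dot_ge0// divr_ge0// ltW.
Qed.

(** If one of the times were [T], the terminal condition and the spatial
    Lipschitz bound would make the doubled functional too small. *)
Lemma maximum_not_terminal {R n Om T eps nu w v f H C K L} {x0 x y t0 t s lam d tau eta}
    (D : @comparison_pair R n Om T eps nu w v f H C K L)
    (M : @penalized_maximum R n Om T w v x0 x y t0 t s lam d tau eta) (gap : R) :
  gap < w (x, t) - v (y, s) - penalty T x0 lam d tau eta ((x, t), (y, s)) ->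
  K ^+ 2 * d / 2 + C * `|t - s| <= gap -> t < T /\ s < T.
Proof.
have [_ _ T0 eps0 _ [C0 K0 L0] lipw lipv _ lipvx _ _ wvT _ _ _] := D.
have [lam0 d0 tau0 eta0 Ox0 t0T cx cy tt ss _] := M.
have t_itv := maximum_time_range M.
have penalty_ge0 := penalty_terms_ge0 M.
move=> Mgap gap_le.
suff maxT : Num.max t s < T by move: maxT; rewrite gt_max => /andP[].
have /andP[t1 t2] := tt; have /andP[s1 s2] := ss.
rewrite lt_neqAle ge_max t2 s2 !andbT; apply/negP => /eqP maxT.
have ts : (T - t) + (T - s) = `|t - s|.
  move: maxT; case: (leP t s) => h ->.
    by rewrite subrr addr0 ler0_norm ?subr_le0// opprB.
  by rewrite subrr add0r ger0_norm ?subr_ge0// ltW.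
have := difference_le_terminal T0 C0 lipw lipv wvT cx cy t_itv ss lipvx.
have := young_le K `|x - y| d0; have [p1 p2 p3 p4] := penalty_ge0.
move: Mgap gap_le p1 p2 p3 p4; rewrite ts /penalty /=; clear; lra.
Qed.

Lemma maximum_penalty_bounded {R n Om T eps nu w v f H C K L} {x0 x y t0 t s lam d tau eta}
    (D : @comparison_pair R n Om T eps nu w v f H C K L)
    (M : @penalized_maximum R n Om T w v x0 x y t0 t s lam d tau eta) :
  0 < w (x, t) - v (y, s) - penalty T x0 lam d tau eta ((x, t), (y, s)) ->
  eta / 2 * (dot (x - x0) (x - x0) + dot (y - x0) (y - x0)) <= K ^+ 2 * d / 2 + 2 * C * T.
Proof.
have [_ _ T0 eps0 _ [C0 K0 L0] lipw lipv _ lipvx _ _ wvT _ _ _] := D.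
have [lam0 d0 tau0 eta0 Ox0 t0T cx cy tt ss _] := M.
have t_itv := maximum_time_range M.
have penalty_ge0 := penalty_terms_ge0 M.
move=> M0; have /andP[t1 t2] := t_itv; have /andP[s1 s2] := ss.
have CT : C * (T - t + (T - s)) <= 2 * C * T.
  by rewrite [2 * C]mulrC -mulrA ler_pM2l//; move: t1 s1; clear; lra.
have := difference_le_terminal T0 C0 lipw lipv wvT cx cy t_itv ss lipvx.
have := young_le K `|x - y| d0; have [p1 p2 p3 _] := penalty_ge0.
move: M0 CT p1 p2 p3; rewrite /penalty /=; clear; lra.
Qed.

(** Comparison with the point where [s] is replaced by [t]. *)
Lemma maximum_times_close {R n Om T eps nu w v f H C K L} {x0 x y t0 t s lam d tau eta}
    (D : @comparison_pair R n Om T eps nu w v f H C K L)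
    (M : @penalized_maximum R n Om T w v x0 x y t0 t s lam d tau eta) :
  `|t - s| <= 2 * (tau * C).
Proof.
have [_ _ T0 eps0 _ [C0 K0 L0] _ lipv _ _ _ _ _ _ _ _] := D.
have [lam0 d0 tau0 eta0 Ox0 t0T cx cy tt ss maximal] := M.
have t_itv := maximum_time_range M.
have := maximal _ _ _ _ cx cy tt t_itv; rewrite /penalty /= subrr expr0n /= mul0r => h.
have /ler_normlP[_ hv] : `|v (y, t) - v (y, s)| <= C * `|t - s|.
  apply: le_trans (lipv _ _ _ _) _; [by split => //=; rewrite in_itv..|].
  by rewrite ler_pM2l//; apply: norm_pair_le => //=; rewrite subrr normr0.
have h3 : (t - s) ^+ 2 / (2 * tau) <= C * `|t - s| by move: h hv; clear; lra.
have [->|tsn0] := eqVneq `|t - s| 0; first by rewrite !mulr_ge0// ltW.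
have tsp : 0 < `|t - s| by rewrite lt_neqAle eq_sym tsn0 /=.
rewrite -(ler_pM2r tsp) -expr2 -normrX ger0_norm ?sqr_ge0//.
move: h3; rewrite ler_pdivrMr ?mulr_gt0//; clear; lra.
Qed.

(** The distance of the maximum point from [x0] may grow as [eta] tends to
    zero, but the gradient [eta * (x - x0)] of the localisation does not. *)
Lemma maximum_localized {R n Om T eps nu w v f H C K L} {x0 x y t0 t s lam d tau eta}
    (D : @comparison_pair R n Om T eps nu w v f H C K L)
    (M : @penalized_maximum R n Om T w v x0 x y t0 t s lam d tau eta) (k : R) :
  0 < k -> k * n%:R <= 1 ->
  2 * (eta * (K ^+ 2 * d / 2 + 2 * C * T)) <= k ^+ 2 ->
  0 < w (x, t) - v (y, s) - penalty T x0 lam d tau eta ((x, t), (y, s)) ->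
  eta * `|x - x0| <= k /\ eta * `|y - x0| <= k.
Proof.
have [_ _ T0 eps0 _ [C0 K0 L0] _ _ _ _ _ _ _ _ _ _] := D.
have [lam0 d0 tau0 eta0 Ox0 t0T cx cy tt ss _] := M.
move=> k0 kn eta_k M0.
have eta2 : 0 <= eta / 2 by rewrite divr_ge0// ltW.
have H0 := maximum_penalty_bounded D M M0.
suff etaZ : forall Z : 'rV[R]_n, eta / 2 * dot Z Z <= K ^+ 2 * d / 2 + 2 * C * T -> eta * `|Z| <= k.
  have XX := dot_ge0 (x - x0); have YY := dot_ge0 (y - x0).
  by split; apply: etaZ; apply: le_trans H0; rewrite ler_wpM2l// ?lerDl ?lerDr.
move=> Z ZB; rewrite -ler_sqr ?nnegrE ?mulr_ge0 ?(ltW eta0) ?(ltW k0)//.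
apply: le_trans eta_k; rewrite exprMn expr2 -mulrA.
set B := _ + _ in ZB *; have -> : 2 * (eta * B) = eta * (2 * B) by ring.
rewrite ler_pM2l//; have := ler_wpM2l (ltW eta0) (sqr_norm_le_dot Z).
move: ZB; clear; lra.
Qed.

(** Comparison with the point where [y] is replaced by [x]. Only [v] is moved,
    so that [|x - y| / d] is bounded independently of the Lipschitz constant of
    [w], which is not controlled. *)
Lemma maximum_points_close {R n Om T eps nu w v f H C K L} {x0 x y t0 t s lam d tau eta}
    (D : @comparison_pair R n Om T eps nu w v f H C K L)
    (M : @penalized_maximum R n Om T w v x0 x y t0 t s lam d tau eta) (k : R) :
  0 < k -> k * n%:R <= 1 ->
  2 * (eta * (K ^+ 2 * d / 2 + 2 * C * T)) <= k ^+ 2 ->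
  0 < w (x, t) - v (y, s) - penalty T x0 lam d tau eta ((x, t), (y, s)) ->
  `|x - y| <= 2 * d * (K + 1).
Proof.
have [_ _ T0 eps0 _ [C0 K0 L0] _ _ _ lipvx _ _ _ _ _ _] := D.
have [lam0 d0 tau0 eta0 Ox0 t0T cx cy tt ss maximal] := M.
have dot00 : dot (0 : 'rV[R]_n) 0 = 0 by rewrite /dot big1// => i _; rewrite mxE mulr0.
have eta2 : 0 <= eta / 2 by rewrite divr_ge0// ltW.
move=> k0 kn eta_k M0.
have [eX eY] := maximum_localized D M k0 kn eta_k M0.
have := maximal _ _ _ _ cx cx tt ss; rewrite /penalty /= subrr dot00 mul0r => h.
have /ler_normlP[_ hv] := lipvx _ _ _ cx cy ss.
have XY : dot (x - x0) (x - x0) - dot (y - x0) (y - x0) = dot (x - y) ((x - x0) + (y - x0)).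
  have -> : x - y = (x - x0) - (y - x0) by rewrite opprB addrA subrK.
  by move: ((x - x0)) ((y - x0)) => X' Y'; rewrite dotBl !dotDr (dotC Y' X'); ring.
have /ler_normlP[_ hXY] := norm_dot_le (x - y) ((x - x0) + (y - x0)).
have h2 : eta / 2 * (dot (x - x0) (x - x0) - dot (y - x0) (y - x0)) <= `|x - y|.
  rewrite XY; apply: le_trans (ler_wpM2l eta2 hXY) _.
  have h4 : eta / 2 * `|(x - x0) + (y - x0)| <= k.
    have := ler_wpM2l eta2 (ler_normD (x - x0) (y - x0)); move: eX eY; clear; lra.
  have -> : eta / 2 * (n%:R * (`|x - y| * `|(x - x0) + (y - x0)|)) =
      `|x - y| * (n%:R * (eta / 2 * `|(x - x0) + (y - x0)|)) by ring.
  rewrite -[leRHS]mulr1 ler_wpM2l//; apply: le_trans kn.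
  by rewrite mulrC ler_wpM2r.
have h3 : dot (x - y) (x - y) / (2 * d) <= (K + 1) * `|x - y|.
  by move: h hv h2; clear; lra.
have [->|rn0] := eqVneq `|x - y| 0; first by rewrite !mulr_ge0// ?addr_ge0// ltW.
have rp : 0 < `|x - y| by rewrite lt_neqAle eq_sym rn0 /=.
rewrite -(ler_pM2r rp) -expr2; apply: le_trans (sqr_norm_le_dot _) _.
by move: h3; rewrite ler_pdivrMr ?mulr_gt0//; clear; lra.
Qed.

Lemma maximum_contact_space {R n Om T w v} {x0 x y t0 t s lam d tau eta}
    (M : @penalized_maximum R n Om T w v x0 x y t0 t s lam d tau eta) x' :
  closure Om x' -> w (x', t) <=
  w (x, t) + dot (d^-1 *: (x - y) + eta *: (x - x0)) (x' - x) +
  (d^-1 + eta) / 2 * dot (x' - x) (x' - x).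
Proof.
have [lam0 d0 tau0 eta0 Ox0 t0T cx cy tt ss maximal] := M.
move=> cx'; have := maximal _ _ _ _ cx' cy tt ss; rewrite /penalty /=.
have -> : x' - y = (x - y) + (x' - x) by rewrite [RHS]addrC subrKA.
have -> : x' - x0 = (x - x0) + (x' - x) by rewrite [RHS]addrC subrKA.
move: (w (x', t)) (x' - x) (x - y) ((x - x0)) ((y - x0)) => w' z a X' Y'.
rewrite !dotDl !dotDr !dotZl (dotC z a) (dotC z X') => h.
have E1 : (dot a a + dot a z + (dot a z + dot z z)) / (2 * d) =
  dot a a / (2 * d) + d^-1 * dot a z + d^-1 / 2 * dot z z.
  by field; rewrite gt_eqF.
by move: h; rewrite E1; clear; lra.
Qed.

Lemma maximum_contact_time {R n Om T w v} {x0 x y t0 t s lam d tau eta}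
    (M : @penalized_maximum R n Om T w v x0 x y t0 t s lam d tau eta) t' :
  t <= t' <= T -> w (x, t') <=
  w (x, t) + ((t - s) / tau - lam) * (t' - t) + (2 * tau)^-1 * (t' - t) ^+ 2.
Proof.
have [lam0 d0 tau0 eta0 Ox0 t0T cx cy tt ss maximal] := M.
move=> /andP[tt' t'T]; have /andP[t1 t2] := tt.
have := maximal _ _ _ _ cx cy (_ : t0 <= t' <= T) ss.
rewrite t'T (le_trans t1 tt') => /(_ isT); rewrite /penalty /= => h.
have E : (t' - s) ^+ 2 / (2 * tau) = (t - s) ^+ 2 / (2 * tau) + (t - s) / tau * (t' - t)
   + (2 * tau)^-1 * (t' - t) ^+ 2 by field; rewrite gt_eqF.
by move: h; rewrite E; clear; lra.
Qed.

Lemma minimum_contact {R n Om T w v} {x0 x y t0 t s lam d tau eta}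
    (M : @penalized_maximum R n Om T w v x0 x y t0 t s lam d tau eta) y' s' :
  closure Om y' -> 0 < s' < T ->
  v (y, s) + quadratic_test y s (d^-1 *: (x - y) - eta *: (y - x0)) (- (d^-1 + eta))
    ((t - s) / tau) (- (2 * tau)^-1) (y', s') <= v (y', s').
Proof.
have [lam0 d0 tau0 eta0 Ox0 t0T cx cy tt ss maximal] := M.
move=> cy' /andP[s'0 s'T]; have ss' : 0 <= s' <= T by rewrite !ltW.
have := maximal _ _ _ _ cx cy' tt ss'; rewrite /penalty /quadratic_test /=.
have -> : x - y' = (x - y) - (y' - y) by rewrite opprB addrA subrK.
have -> : y' - x0 = (y - x0) + (y' - y) by rewrite [RHS]addrC subrKA.
move: (v (y', s')) (y' - y) (x - y) ((x - x0)) ((y - x0)) => v' z a X' Y'.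
rewrite !dotDl !dotDr !dotNl !dotNr !dotZl (dotC z a) (dotC z Y') => h.
have E1 : (dot a a - dot a z + (- dot a z - - dot z z)) / (2 * d) =
  dot a a / (2 * d) - d^-1 * dot a z + d^-1 / 2 * dot z z.
  by field; rewrite gt_eqF.
have E2 : (t - s') ^+ 2 / (2 * tau) = (t - s) ^+ 2 / (2 * tau) - (t - s) / tau * (s' - s)
  + (2 * tau)^-1 * (s' - s) ^+ 2 by field; rewrite gt_eqF.
by move: h; rewrite E2 E1; clear; lra.
Qed.

(** On a convex domain the gradient of the penalty points strictly outwards at
    a boundary point; this is where [eta] cannot be zero. *)
Lemma penalty_gradient_outward {R n Om T eps nu w v f H C K L}
    (D : @comparison_pair R n Om T eps nu w v f H C K L) x0 d eta z z' c :
  0 < d -> 0 < eta -> Om x0 -> frontier Om z -> closure Om z' ->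
  c = d^-1 *: (z - z') + eta *: (z - x0) -> 0 < dot c (nu z).
Proof.
have [oOm cOm T0 eps0 nuOm [C0 K0 L0] _ _ _ _ _ _ _ _ _ _] := D.
move=> d0 eta0 Ox0; have dV : 0 < d^-1 by rewrite invr_gt0.
have Om0 : Om !=set0 by exists x0.
move=> fz cz' ->; rewrite dotDl !dotZl.
have sep0 := normal_separates oOm cOm Om0 fz (nuOm _ fz) Ox0.
have sep' := normal_separates_closure oOm cOm Om0 fz (nuOm _ fz) cz'.
have -> : dot (z - x0) (nu z) = - dot (x0 - z) (nu z) by rewrite -dotNl opprB.
have -> : dot (z - z') (nu z) = - dot (z' - z) (nu z) by rewrite -dotNl opprB.
by rewrite ltr_wpDl ?mulr_gt0 ?oppr_gt0// mulr_ge0 ?(ltW dV)// oppr_ge0.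
Qed.

(** At a boundary point the outward derivative of the penalty is positive, which
    the Neumann condition for [w] forbids. *)
Lemma maximum_interior {R n Om T eps nu w v f H C K L} {x0 x y t0 t s lam d tau eta}
    (D : @comparison_pair R n Om T eps nu w v f H C K L)
    (M : @penalized_maximum R n Om T w v x0 x y t0 t s lam d tau eta) :
  0 < t < T -> Om x.
Proof.
have [oOm cOm T0 eps0 nuOm [C0 K0 L0] _ _ _ _ _ _ _ _ neumann_w _] := D.
have [lam0 d0 tau0 eta0 Ox0 t0T cx cy tt ss _] := M.
pose p := d^-1 *: (x - y) + eta *: (x - x0).
pose q := d^-1 *: (x - y) - eta *: (y - x0).
pose b := d^-1 + eta.
have Om0 : Om !=set0 by exists x0.
move=> tT; have [//|fx] := closure_frontierP oOm cx; exfalso.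
have [dl dl0 hdl] := inward_segment oOm cOm Om0 fx (nuOm _ fx).
have : dot p (nu x) <= 0.
  apply: (neumann_w x t dl (b / 2) _ fx tT dl0) => h hh.
  have := maximum_contact_space M (subset_closure (hdl h hh)); rewrite -/p -/b.
  have -> : x - h *: nu x - x = - h *: nu x by rewrite addrAC subrr add0r scaleNr.
  rewrite !dotZr !dotZl (unit_normal_dot oOm cOm Om0 fx (nuOm _ fx)); clear; lra.
by rewrite leNgt (penalty_gradient_outward D d0 eta0 Ox0 fx cy erefl).
Qed.

(** The difference of the two equations at the maximum point. *)
Lemma maximum_slope_bound {R n Om T eps nu w v f H C K L} {x0 x y t0 t s lam d tau eta}
    (D : @comparison_pair R n Om T eps nu w v f H C K L)
    (M : @penalized_maximum R n Om T w v x0 x y t0 t s lam d tau eta) (k : R) (CH : R) :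
  0 < k -> k * n%:R <= 1 ->
  2 * (eta * (K ^+ 2 * d / 2 + 2 * C * T)) <= k ^+ 2 ->
  0 < w (x, t) - v (y, s) - penalty T x0 lam d tau eta ((x, t), (y, s)) ->
  0 < t < T -> 0 < s < T -> k <= 1 -> 0 < CH ->
  (forall z z', `|z| < 2 * K + 4 -> `|z'| < 2 * K + 4 -> `|H z - H z'| <= CH * `|z - z'|) ->
  lam <= eps * n%:R / d + 2 * L * d * (K + 1) + 2 * (k * CH) + 2 * (tau * C ^+ 2) +
         eta * (eps * n%:R).
Proof.
have [_ _ T0 eps0 _ [C0 K0 L0] _ _ lipf _ lipfx _ _ contact_w _ contact_v] := D.
have [lam0 d0 tau0 eta0 Ox0 t0T cx cy tt ss _] := M.
pose p := d^-1 *: (x - y) + eta *: (x - x0).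
pose q := d^-1 *: (x - y) - eta *: (y - x0).
pose b := d^-1 + eta.
have t_itv := maximum_time_range M.
have dV : 0 < d^-1 by rewrite invr_gt0.
move=> k0 kn eta_k M0.
move=> tT sT k1 CH0 hCH; have Ox := maximum_interior D M tT.
have [eX eY] := maximum_localized D M k0 kn eta_k M0.
have rd := maximum_points_close D M k0 kn eta_k M0.
have ineq_w := contact_w _ _ _ _ _ _ Ox tT
  (fun y Oy => maximum_contact_space M (subset_closure Oy)) (maximum_contact_time M).
rewrite -/p -/b in ineq_w.
have ineq_v : 0 <= - ((t - s) / tau) + H q - f (y, s).
  apply: (contact_v _ _ _ _ _ _ cy sT (minimum_contact M)) => fy.
  rewrite -oppr_gt0 -dotNl; apply: (penalty_gradient_outward D d0 eta0 Ox0 fy cx).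
  by rewrite /q opprB addrC -scalerN opprB.
have rdV : d^-1 * `|x - y| <= 2 * K + 2.
  by rewrite mulrC ler_pdivrMr//; move: rd; clear; lra.
have p_lt : `|p| < 2 * K + 4.
  apply: le_lt_trans (ler_normD _ _) _; rewrite !normrZ !gtr0_norm//.
  by move: rdV eX k1; clear; lra.
have q_lt : `|q| < 2 * K + 4.
  apply: le_lt_trans (ler_normB _ _) _; rewrite !normrZ !gtr0_norm//.
  by move: rdV eY k1; clear; lra.
have Hqp : H q - H p <= 2 * (k * CH).
  have /ler_normlP[_ h] := hCH _ _ q_lt p_lt; apply: le_trans h _.
  have -> : q - p = - (eta *: (x - x0) + eta *: (y - x0)).
    by rewrite /q /p; move: (d^-1 *: _) (_ *: (x - x0)) (_ *: (y - x0)) => a1 a2 a3;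
       apply/rowP => i; rewrite !mxE; ring.
  have : `|- (eta *: (x - x0) + eta *: (y - x0))| <= 2 * k.
    rewrite normrN; apply: le_trans (ler_normD _ _) _; rewrite !normrZ !gtr0_norm//.
    by move: eX eY; clear; lra.
  by move=> /(ler_wpM2l (ltW CH0)); clear; lra.
have fxy : f (x, t) - f (y, s) <= L * `|x - y| + C * `|t - s|.
  have /ler_normlP[_ h1] := lipfx _ _ _ cx cy t_itv.
  have /ler_normlP[_ h2] : `|f (y, t) - f (y, s)| <= C * `|t - s|.
    apply: le_trans (lipf _ _ _ _) _; [by split => //=; rewrite in_itv..|].
    by rewrite ler_pM2l//; apply: norm_pair_le => //=; rewrite subrr normr0.
  by move: h1 h2; clear; lra.
have Lr := ler_wpM2l L0 rd.
have Ct := ler_wpM2l (ltW C0) (maximum_times_close D M).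
have epsb : eps * (n%:R * b) = eps * n%:R / d + eta * (eps * n%:R) by rewrite /b; ring.
move: ineq_w ineq_v Hqp fxy Lr Ct; rewrite epsb; clear; lra.
Qed.


Lemma half_estimate {R n Om T eps nu w v f H C K L}
    (D : @comparison_pair R n Om T eps nu w v f H C K L) x0 t0 : Om x0 -> 0 < t0 < T ->
  w (x0, t0) - v (x0, t0) <=
    (n%:R + 2 * L * (K + 1) * T + K ^+ 2 / 2 + 2) * Num.sqrt (eps * T).
Proof.
have [_ _ T0 eps0 _ [C0 K0 L0] lipw lipv _ _ _ lipH wvT _ _ _] := D.
move=> Ox0 t0T; have /andP[t00 t0T'] := t0T.
pose d := Num.sqrt (eps * T).
have d0 : 0 < d by rewrite sqrtr_gt0 mulr_gt0.
have dd : d ^+ 2 = eps * T by rewrite sqr_sqrtr// mulr_ge0// ltW.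
rewrite leNgt -/d; apply/negP => big.
(* the last term makes the bound of [maximum_slope_bound] fail *)
pose lam := eps * n%:R / d + 2 * L * d * (K + 1) + d / T.
have lam0 : 0 <= lam.
  by rewrite /lam !addr_ge0// ?divr_ge0// ?mulr_ge0// ?addr_ge0// ltW.
have lamT : lam * T = (n%:R + 2 * L * (K + 1) * T + 1) * d.
  have -> : lam * T = eps * T * n%:R / d + 2 * L * d * (K + 1) * T + d.
    by rewrite /lam; field; rewrite !gt_eqF.
  by rewrite -dd; field; rewrite gt_eqF.
pose gap := (K ^+ 2 / 2 + 1) * d.
have gap0 : 0 < gap by rewrite mulr_gt0// ltr_wpDl// divr_ge0// sqr_ge0.
have gapE : gap < w (x0, t0) - v (x0, t0) - lam * (T - t0).
  have : lam * (T - t0) <= lam * T by rewrite ler_wpM2l// lerBlDr lerDl ltW.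
  move: big; rewrite lamT /gap; clear; lra.
have K4 : 0 < 2 * K + 4 by move: K0; clear; lra.
have [CH CH0 hCH] := lipH _ K4.
pose B := K ^+ 2 * d / 2 + 2 * C * T.
have B0 : 0 <= B by rewrite /B addr_ge0// ?divr_ge0// !mulr_ge0// ?sqr_ge0// ltW.
pose e := d / (4 * T).
have e0 : 0 < e by rewrite divr_gt0// mulr_gt0.
have n0 : 0 <= n%:R :> R by [].
(* [k] bounds the localisation gradient, so it is chosen before [eta] *)
have [k [k0 k1 hk]] : exists k, [/\ 0 < k, k <= 1 & k * (n%:R + 2 * CH) <= Num.min 1 e].
  by apply: small_multiplier; rewrite ?lt_min ?ltr01// addr_ge0// mulr_ge0// ltW.
have [eta [eta0 _ heta]] : exists k', [/\ 0 < k', k' <= 1 &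
    k' * (2 * B + eps * n%:R) <= Num.min (k ^+ 2) e].
  apply: small_multiplier; last by rewrite lt_min e0 exprn_gt0.
  by rewrite addr_ge0// mulr_ge0// ltW.
have [tau [tau0 _ htau]] : exists k', [/\ 0 < k', k' <= 1 &
    k' * (2 * C ^+ 2 + 2 * C) <= Num.min (Num.min e (t0 / 2)) d].
  apply: small_multiplier; last by rewrite !lt_min e0 d0 divr_gt0.
  by rewrite !addr_ge0 ?mulr_ge0 ?sqr_ge0// ltW.
have [kn1 kCH1] : k * n%:R <= 1 /\ 2 * (k * CH) <= e.
  have h3 : 0 <= k * CH by rewrite mulr_ge0// ltW.
  have h4 : 0 <= k * n%:R by rewrite mulr_ge0// ltW.
  by move: hk; rewrite le_min => /andP[h1 h2]; split; move: h1 h2 h3 h4; clear; lra.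
have [etaB1 etan1] : 2 * (eta * B) <= k ^+ 2 /\ eta * (eps * n%:R) <= e.
  have h3 : 0 <= eta * B by rewrite mulr_ge0// ltW.
  have h4 : 0 <= eta * (eps * n%:R) by rewrite !mulr_ge0// ltW.
  move: heta; rewrite le_min => /andP[]; move: (k ^+ 2) (e) h3 h4 => k2 e'.
  by clear => h1 h2 h3 h4; split; move: h1 h2 h3 h4; clear; lra.
have [tau1 tau2 tau3] : [/\ 2 * (tau * C ^+ 2) <= e, 2 * (tau * C) <= t0 / 2 &
    C * (2 * (tau * C)) <= d].
  have h3 : 0 <= tau * C by rewrite mulr_ge0// ltW.
  have h4 : 0 <= tau * C ^+ 2 by rewrite mulr_ge0 ?sqr_ge0// ltW.
  move: htau; rewrite !le_min => /andP[/andP[]]; move: (e) h3 h4 => e'.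
  by clear => h3 h4 h1 h2 h5; split; move: h1 h2 h3 h4 h5; clear; lra.
have [x [t [y [s [cx cy tt ss Mmax]]]]] :=
  doubled_maximum T0 C0 lipw lipv wvT Ox0 t0T lam0 d0 tau0 eta0 (lt_trans gap0 gapE).
have Mgap : gap < w (x, t) - v (y, s) - penalty T x0 lam d tau eta ((x, t), (y, s)).
  apply: (lt_le_trans gapE).
  have tt0 : t0 <= t0 <= T by rewrite lexx ltW.
  have ss0 : 0 <= t0 <= T by rewrite !ltW.
  have cx0 : closure Om x0 by exact: subset_closure.
  have dot00 : dot (0 : 'rV[R]_n) 0 = 0 by rewrite /dot big1// => i _; rewrite mxE mulr0.
  have := Mmax x0 t0 x0 t0 cx0 cx0 tt0 ss0.
  by rewrite /penalty /= !subrr dot00 expr0n/= !mul0r !addr0 mulr0 addr0.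
have M0 := lt_trans gap0 Mgap.
have M := PenalizedMaximum lam0 d0 tau0 eta0 Ox0 t0T cx cy tt ss Mmax.
have ts := maximum_times_close D M.
have [tT sT] : t < T /\ s < T.
  apply: (maximum_not_terminal D M Mgap).
  have := ler_wpM2l (ltW C0) ts; move: tau3; rewrite /gap; clear; lra.
have t_pos : 0 < t by move: tt => /andP[h _]; apply: lt_le_trans h.
have s_pos : 0 < s.
  move: ts tt => /ler_normlP[h1 h2] /andP[h3 _]; move: h2 h3 tau2 t00; clear; lra.
have ttT : 0 < t < T by rewrite t_pos.
have ssT : 0 < s < T by rewrite s_pos.
have := maximum_slope_bound D M k0 kn1 etaB1 M0 ttT ssT k1 CH0 hCH.
have dT4 : d / T = 4 * e by rewrite /e; field; rewrite gt_eqF.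
move: kCH1 tau1 etan1 e0; rewrite /lam dT4; clear; lra.
Qed.

(** * The convergence rate *)

(** For [sg = -1] the equations are multiplied by [-1], which exchanges contact
    from above and from below. *)
Lemma comparison_pair_of_solutions {R : realType} {n : nat} (Om : set 'rV[R]_n) (T eps : R)
    (nu : 'rV[R]_n -> 'rV[R]_n) (H : 'rV[R]_n -> R) (f : 'rV[R]_n * R -> R)
    (uT : 'rV[R]_n -> R) (ueps u : 'rV[R]_n * R -> R) (K L sg : R) :
  open Om -> convex_domain Om -> 0 < T -> 0 < eps ->
  (forall x, frontier Om x -> outward_unit_normal Om x (nu x)) ->
  W1infty_loc H -> W1infty (closed_cylinder Om T) f ->
  viscous_solution Om T nu H f uT eps ueps ->
  [lipschitz ueps p | p in closed_cylinder Om T] ->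
  viscosity_solution Om T nu H f uT u ->
  [lipschitz u p | p in closed_cylinder Om T] ->
  Linfty_norm (closed_cylinder Om T) (grad_length u) = K%:E ->
  Linfty_norm (cylinder Om T) (grad_length f) = L%:E ->
  sg = 1 \/ sg = -1 ->
  exists C, comparison_pair Om T eps nu (fun p => sg * ueps p) (fun p => sg * u p)
    (fun p => sg * f p) (fun p => sg * H (sg *: p)) C
    (n%:R * (`|K| + 1)) (n%:R * (`|L| + 1)).
Proof.
move=> oOm cOm T0 eps0 nuOm WH [_ lf] vw lw vu lu uK fL sg1.
have sgsg : sg * sg = 1 by case: sg1 => ->; rewrite ?mulr1// mulrN1 opprK.
have nsg : `|sg| = 1 by case: sg1 => ->; rewrite ?normrN normr1.
have [Cw Cw0 Hw] := lipschitz_constant lw.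
have [Cu Cu0 Hu] := lipschitz_constant lu.
have [Cf Cf0 Hf] := lipschitz_constant lf.
have sgN a b : `|sg * a - sg * b| = `|a - b| by rewrite -mulrBr normrM nsg mul1r.
have absK : 0 <= `|K| + 1 by rewrite addr_ge0.
have absL : 0 <= `|L| + 1 by rewrite addr_ge0.
have cyl_closed : cylinder Om T `<=` closed_cylinder Om T.
  move=> p [Op /=]; rewrite in_itv /= => /andP[p0 pT]; split => /=.
    exact: subset_closure.
  by rewrite in_itv /= !ltW.
exists (Cw + Cu + Cf); split => //.
- by rewrite !addr_gt0// !mulr_ge0.
- move=> p q cp cq; rewrite sgN; apply: le_trans (Hw _ _ cp cq) _.
  by rewrite ler_wpM2r// -addrA lerDl addr_ge0// ltW.
- move=> p q cp cq; rewrite sgN; apply: le_trans (Hu _ _ cp cq) _.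
  by rewrite ler_wpM2r// addrAC lerDr addr_ge0// ltW.
- move=> p q cp cq; rewrite sgN; apply: le_trans (Hf _ _ cp cq) _.
  by rewrite ler_wpM2r// lerDr addr_ge0// ltW.
- move=> x y t cx cy tT; rewrite sgN.
  apply: (grad_bound_lipschitz oOm cOm T0 lu absK _ cx cy tT).
  apply: (@lebesgue_null_sub _ _ _ (closed_cylinder Om T `&`
     [set p | ~ (`|grad_length u p| <= (`|K| + 1)%:E)%E])).
    by move=> p [/cyl_closed].
  apply: (Linfty_norm_null uK); apply: le_lt_trans (ler_norm K) _; by rewrite ltrDl.
- move=> x y t cx cy tT; rewrite sgN.
  apply: (grad_bound_lipschitz oOm cOm T0 lf absL _ cx cy tT).
  apply: (Linfty_norm_null fL); apply: le_lt_trans (ler_norm L) _; by rewrite ltrDl.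
- move=> r r0; have [_ /lipschitz_constant[CH CH0 HH]] := WH r r0.
  exists CH => // p q pr qr; rewrite sgN.
  have br z : `|z| < r -> ball (0 : 'rV[R]_n) r (sg *: z).
    by move=> zr; rewrite -ball_normE /= sub0r normrN normrZ nsg mul1r.
  apply: le_trans (HH _ _ (br _ pr) (br _ qr)) _.
  by rewrite -scalerBr normrZ nsg mul1r.
- move=> x cx; congr (_ * _); apply/eqP; rewrite -subr_eq0 -normr_le0.
  apply/ler_addgt0Pr => e e0; rewrite add0r.
  have CC : 0 < Cw + Cu by rewrite addr_gt0.
  have [x' Ox' xx'] := closure_ball cx (divr_gt0 e0 CC).
  have cylT z : closure Om z -> closed_cylinder Om T (z, T).
    by move=> cz; split => //=; rewrite in_itv /= lexx ltW.
  have [_ _ _ _ wT] := vw; have [_ _ _ uT'] := vu.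
  have h1 := Hw _ _ (cylT _ cx) (cylT _ (subset_closure Ox')).
  have h2 := Hu _ _ (cylT _ cx) (cylT _ (subset_closure Ox')).
  have d1 : `|((x, T) : 'rV[R]_n * R) - (x', T)| <= `|x - x'|.
    by apply: norm_pair_le => //=; rewrite subrr normr0.
  have -> : ueps (x, T) - u (x, T) =
      (ueps (x, T) - ueps (x', T)) - (u (x, T) - u (x', T)).
    by rewrite wT// uT'//; ring.
  apply: le_trans (ler_normB _ _) _.
  have := ler_wpM2l (ltW Cw0) d1; have := ler_wpM2l (ltW Cu0) d1.
  move: xx'; rewrite ltr_pdivlMr// => xx'.
  move: h1 h2 xx'; clear; lra.
- by move=> x t a b c p Ox tT Hx Ht;
    exact: (viscous_solution_contact oOm eps0 vw sgsg Ox tT Hx Ht).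
- move=> x t d b k fx tT d0 Hh; have [_ _ _ Nw _] := vw.
  exact: (neumann_contact Nw fx tT d0 Hh).
- move=> y0 s0 a b c q cy0 s0T touch qnu.
  exact: (viscosity_solution_contact oOm vu sg1 cy0 s0T touch qnu).
Qed.

(* [K] and [L] are the norms of [Du] and [Df].  Besides [n], [K], [L], the constant
   sees only the fixed horizon [T], monotonically, so it is uniform on bounded
   ranges of [T]. *)
Theorem theorem3p1 (R : realType) :
  exists M : nat -> R -> R -> R -> R,
  [/\ forall n K L T, 0 < M n K L T,
      forall n K L, {homo M n K L : S T / S <= T} &
      forall (n : nat) (T : R) (Om : set 'rV[R]_n) (nu : 'rV[R]_n -> 'rV[R]_n)
        (H : 'rV[R]_n -> R) (f : 'rV[R]_n * R -> R) (uT : 'rV[R]_n -> R)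
        (eps : R) (ueps u : 'rV[R]_n * R -> R) (K L : R),
      (0 < n)%N -> 0 < T ->
      is_domain Om -> smooth_boundary Om ->
      (bounded_set Om /\ convex_domain Om) \/
        [/\ ~ bounded_set Om, convex_domain Om & interior_cone_condition Om] ->
      (forall x, frontier Om x -> outward_unit_normal Om x (nu x)) ->
      W1infty_loc H ->
      W1infty (closed_cylinder Om T) f ->
      0 < eps ->
      viscous_solution Om T nu H f uT eps ueps ->
      [lipschitz ueps p | p in closed_cylinder Om T] ->
      viscosity_solution Om T nu H f uT u ->
      [lipschitz u p | p in closed_cylinder Om T] ->
      Linfty_norm (closed_cylinder Om T) (grad_length u) = K%:E ->
      Linfty_norm (cylinder Om T) (grad_length f) = L%:E ->
      (Linfty_norm (cylinder Om T) (fun p => (ueps p - u p)%:E)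
         <= (M n K L T * Num.sqrt (eps * T))%:E)%E].
Proof.
(* [Num.max T 0] keeps the constant positive and monotone for negative [T] *)
exists (fun n K L T => n%:R + 2 * (n%:R * (`|L| + 1)) * (n%:R * (`|K| + 1) + 1) * Num.max T 0
  + (n%:R * (`|K| + 1)) ^+ 2 / 2 + 2).
have coef n K L : 0 <= 2 * (n%:R * (`|L| + 1)) * (n%:R * (`|K| + 1) + 1) :> R.
  by rewrite !(mulr_ge0, addr_ge0).
split.
- move=> n K L T; rewrite ltr_wpDl//; apply: addr_ge0; last by rewrite divr_ge0 ?sqr_ge0.
  by apply: addr_ge0 => //; apply: mulr_ge0; rewrite ?coef// le_max lexx orbT.
- move=> n K L S T ST; rewrite !lerD2r lerD2l ler_wpM2l//.
  by rewrite ge_max !le_max ST lexx !orbT.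
move=> n T Om nu H f uT eps ueps u K L _ T0 [oOm Om0 _] _ cOm nuOm WH Wf eps0 vw lw vu lu uK fL.
have {}cOm : convex_domain Om by case: cOm => [[]|[]].
rewrite max_l ?(ltW T0)//.
apply: Linfty_norm_le => -[x t] [/= Ox]; rewrite in_itv /= => tT.
have half sg : sg = 1 \/ sg = -1 -> sg * ueps (x, t) - sg * u (x, t) <=
    (n%:R + 2 * (n%:R * (`|L| + 1)) * (n%:R * (`|K| + 1) + 1) * T
     + (n%:R * (`|K| + 1)) ^+ 2 / 2 + 2) * Num.sqrt (eps * T).
  move=> sg1; have [C D] := comparison_pair_of_solutions oOm cOm T0 eps0 nuOm WH Wf
    vw lw vu lu uK fL sg1.
  exact: (half_estimate D Ox tT).
apply/ler_normlP; split.
  by have := half (-1) (or_intror erefl); rewrite !mulN1r opprB opprK addrC.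
by have := half 1 (or_introl erefl); rewrite !mul1r.
Qed.
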